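(* The quasi-order $(\mathscr P(\omega),\subseteq^* )$ embeds into $(\mathbf\Sigma^0_2(\mathbb R^2),\le_{\mathsf D_2})$: there is a map $x\mapsto C_x$ from $\mathscr P(\omega)$ to $\mathbf\Sigma^0_2(\mathbb R^2)$ such that for all $x,y\subseteq\omega$, $x\subseteq^*y$ if and only if $C_x\le_{\mathsf D_2}C_y$.
   Context: $x\subseteq^*y$ means $x\setminus y$ is finite. $\mathbf\Sigma^0_2(\mathbb R^2)$ is the class of countable unions of closed subsets of $\mathbb R^2$. $\mathsf D_2(\mathbb R^2)$ is the set of $f\colon\mathbb R^2\to\mathbb R^2$ with $f^{-1}(A)\in\mathbf\Sigma^0_2(\mathbb R^2)$ for every $A\in\mathbf\Sigma^0_2(\mathbb R^2)$, and $C\le_{\mathsf D_2}D$ iff $C=f^{-1}(D)$ for some $f\in\mathsf D_2(\mathbb R^2)$. *)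

(* Defs.v *)
From HB Require Import structures.
From mathcomp Require Import all_boot all_order all_algebra.
From mathcomp Require Import all_classical all_reals all_analysis.
From mathcomp Require Import borel_hierarchy.

Set Implicit Arguments.
Unset Strict Implicit.
Unset Printing Implicit Defensive.

Import numFieldNormedType.Exports.

Local Open Scope classical_set_scope.

Definition almost_subset (x y : set nat) : Prop := finite_set (x `\` y).

(* The pointclass Sigma^0_2(T), countable unions of closed sets, is [Fsigma]. *)
Definition D2_fun (T : topologicalType) (f : T -> T) : Prop :=
  forall A : set T, Fsigma A -> Fsigma (f @^-1` A).

Definition D2_le (T : topologicalType) (C D : set T) : Prop :=
  exists2 f : T -> T, D2_fun f & C = f @^-1` D.

(* Main.v *)
Require Import Defs.
From HB Require Import structures.
From mathcomp Require Import all_boot all_order all_algebra.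
From mathcomp Require Import all_classical all_reals all_analysis.
From mathcomp Require Import borel_hierarchy.
From mathcomp Require Import zify ring lra.
Import numFieldNormedType.Exports.
Import Order.TTheory GRing.Theory Num.Theory.
Local Open Scope classical_set_scope.
Local Open Scope ring_scope.

(* The base is the countable set of finite sums of digits -1, 0, 1 times 5^-i, where the even
   positions are always allowed and position 2k+1 only if k is in x. The code C_x puts over such a
   sum a subset of the vertical line that depends only on its last position: the whole line for an
   even position, the k-th pattern for position 2k+1.
   If almost all of x is in y, cutting off a fixed finite number of leading digits is a translation
   on each of finitely many closed pieces, and reduces C_x to C_y.
   Conversely a D2 function is continuous on a portion of every closed set. Take the closure of
   the base times the line: its portion contains a long piece of the k-th pattern for almost all k
   in x. Along this piece the image cannot move horizontally, because full lines and lines missing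
   the code accumulate on both sides of every coded line. So it stays on a line carrying a pattern
   of some index m in y. Patterns are zigzags whose dips are missing exactly at the multiples of
   the k-th prime, and following one of them inside another forces the primes to agree, so m = k. *)

(** * F_sigma sets *)

Lemma Fsigma_bigcup_nat (T : topologicalType) (F : nat -> set T) :
  (forall i, Fsigma (F i)) -> Fsigma (\bigcup_i F i).
Proof.
move=> FF; have /choice[G GP] i : exists G : nat -> set T,
    (forall j, closed (G j)) /\ F i = \bigcup_j G j.
  by have [G cG ->] := FF i; exists G.
have cG i j : closed (G i j) := (GP i).1 j.
have FG i : F i = \bigcup_j G i j := (GP i).2.
exists (fun n => match unpickle n with
                 | Some (i, j) => G i j
                 | None => set0
                 end) => [n|].
  by case: (unpickle n) => [[i j]|] //; exact: closed0.
apply/seteqP; split => [x [i _]|x [n _]].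
  by rewrite FG => -[j _ Gx]; exists (pickle (i, j)) => //; rewrite pickleK.
by case: (unpickle n) => [[i j] Gx|//]; exists i => //; rewrite FG; exists j.
Qed.

Lemma Fsigma0 (T : topologicalType) : Fsigma (@set0 T).
Proof. by apply: closed_Fsigma; exact: closed0. Qed.

Lemma FsigmaT (T : topologicalType) : Fsigma (@setT T).
Proof. by apply: closed_Fsigma; exact: closedT. Qed.

Lemma Fsigma_bigcup (T : topologicalType) (I : countType) (D : set I)
  (F : I -> set T) : (forall i, D i -> Fsigma (F i)) -> Fsigma (\bigcup_(i in D) F i).
Proof.
move=> FF; suff -> : \bigcup_(i in D) F i =
    \bigcup_n (match unpickle n with
               | Some i => if `[< D i >] then F i else set0 | None => set0 end).
  apply: Fsigma_bigcup_nat => n; case: (unpickle n) => [i|]; last exact: Fsigma0.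
  by case: asboolP => [Di|_]; [exact: FF|exact: Fsigma0].
apply/seteqP; split => [x [i Di Fx]|x [n _]].
  by exists (pickle i) => //; rewrite pickleK; case: asboolP.
by case: (unpickle n) => [i|//]; case: asboolP => // Di Fx; exists i.
Qed.

Lemma Fsigma_setU (T : topologicalType) (A B : set T) :
  Fsigma A -> Fsigma B -> Fsigma (A `|` B).
Proof.
move=> FA FB.
suff -> : A `|` B = \bigcup_(b in [set: bool]) (if b then A else B).
  by apply: Fsigma_bigcup => -[].
apply/seteqP; split => [x [Ax|Bx]|x [[] _ ?]]; [by exists true|by exists false| |].
  by left.
by right.
Qed.

Lemma Fsigma_setI (T : topologicalType) (A B : set T) :
  Fsigma A -> Fsigma B -> Fsigma (A `&` B).
Proof.
move=> [F cF ->] [G cG ->].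
rewrite setI_bigcupl; apply: Fsigma_bigcup => i _.
rewrite setI_bigcupr; apply: Fsigma_bigcup => j _.
by apply: closed_Fsigma; apply: closedI.
Qed.

Lemma Fsigma_preimage (T U : topologicalType) (f : T -> U) (A : set U) :
  continuous f -> Fsigma A -> Fsigma (f @^-1` A).
Proof.
move=> cf [F cF ->]; exists (fun i => f @^-1` F i) => [i|].
  by move/continuous_closedP: cf; apply.
by rewrite preimage_bigcup.
Qed.

Lemma Fsigma_finite (T : topologicalType) (I : choiceType) (D : set I)
  (F : I -> set T) : finite_set D -> (forall i, D i -> Fsigma (F i)) ->
  Fsigma (\bigcup_(i in D) F i).
Proof.
move=> /finite_seqP[s ->] FF.
suff -> : \bigcup_(i in [set` s]) F i =
   \bigcup_(n in [set n | (n < size s)%N])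
     (match ohead (drop n s) with Some i => F i | None => set0 end).
  apply: Fsigma_bigcup => n /= ns.
  (* [I] may be empty a priori, so the default for [nth] is built from the element of [s] that
     [n < size s] provides. *)
  rewrite (drop_nth (head (nth (xchoose (ex_intro xpredT (tnth (in_tuple s) (Ordinal ns)) isT)) s n) s)) //=.
  by apply: FF => /=; exact: mem_nth.
apply/seteqP; split => x [] /=.
  move=> i si Fx; exists (index i s); first by rewrite /= index_mem.
  by rewrite (drop_nth i) ?index_mem //= nth_index.
move=> n ns; case E : (drop n s) => [|i t] //= Fx; exists i => //=.
by apply: (@mem_drop n); rewrite E mem_head.
Qed.

Lemma exists_natSinv_lt (R : archiRealFieldType) (e : R) :
  0 < e -> exists n, n.+1%:R^-1 < e.
Proof.
move=> e0; exists (Num.truncn e^-1).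
by rewrite invf_plt ?posrE// truncnS_gt.
Qed.

(** The closed pieces are the points left uncovered by small balls about the points outside [A].
    Interiors are taken because balls of a pseudometric structure need not be open. *)
Lemma open_Fsigma (R : realType) (T : pseudoMetricType R) (A : set T) :
  open A -> Fsigma A.
Proof.
move=> oA.
exists (fun n => ~` \bigcup_(x in ~` A) (ball x n.+1%:R^-1)^°) => [n|].
  apply: open_closedC; apply: bigcup_open => x _; exact: open_interior.
apply/seteqP; split => [x Ax|x [n _] /= Nx].
  have /nbhs_ballP[e /= e0 xA] : nbhs x A by rewrite nbhsE; exists A.
  have [n ne] := exists_natSinv_lt _ _ e0.
  exists n => //= -[y nAy /interior_subset yx].
  apply: nAy; apply: xA; apply: ball_sym; exact: le_ball (ltW ne) _ yx.
apply: contrapT => nAx; apply: Nx; exists x => //.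
by apply: nbhsx_ballx.
Qed.

(** * D2 functions are continuous on a portion of every closed set *)

Section portions.
Context (R : realType) (T : pseudoMetricType R).
Hypothesis locally_compactT : forall x : T, exists2 K, nbhs x K & compact K.

(** The portion proper is the nonempty trace of [W] on [X]; only the open set [W] is carried
    around. *)
Definition portion (X W : set T) : Prop := open W /\ X `&` W !=set0.

(** Baire category relative to [X]. Otherwise portions can be shrunk with nested closures so as to
    leave the closed pieces of all [A i] one by one, and a point common to them contradicts the
    covering. *)
Lemma portion_Baire (X W : set T) (I : countType) (A : I -> set T) :
  closed X -> portion X W -> (forall i, Fsigma (A i)) ->
  X `&` W `<=` \bigcup_i A i ->
  exists i W', [/\ portion X W', W' `<=` W & X `&` W' `<=` A i].
Proof.
move=> cX [oW [x0 [Xx0 Wx0]]] AF XWA.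
have /choice[F FP] : forall i, exists F : nat -> set T,
    (forall j, closed (F j)) /\ A i = \bigcup_j F j.
  by move=> i; have [G cG ->] := AF i; exists G.
apply: contrapT => NA.
have step (i : I) (j : nat) (U : set T) : portion X U -> U `<=` W ->
    exists U', [/\ portion X U', U' `<=` W & closure U' `<=` U `\` F i j].
  move=> [oU [y [Xy Uy]]] UW.
  have [x [Xx Ux NFx]] : exists x, [/\ X x, U x & ~ F i j x].
    apply: contrapT => NF; apply: NA; exists i, U; split => //.
      by split => //; exists y.
    move=> x [Xx Ux]; rewrite (FP i).2; exists j => //.
    by apply: contrapT => NFx; apply: NF; exists x.
  have : nbhs x (U `\` F i j).
    apply: open_nbhs_nbhs; split => //; apply: openI => //.
    by apply: closed_openC; exact: (FP i).1.
  move=> /uniform_regular[B Bx BU]; exists (B°); split.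
  - by split; [exact: open_interior|exists x; split].
  - apply: (subset_trans _ UW) => z /interior_subset Bz.
    by have [] := BU _ (subset_closure Bz).
  - by apply: subset_trans BU; apply: closure_subset; exact: interior_subset.
pose step' (n : nat) (U U' : set T) :=
  [/\ portion X U', U' `<=` W, closure U' `<=` U &
      forall i j, pickle (i, j) = n -> closure U' `&` F i j = set0].
have /choice[G GP] : forall nU : nat * set T, exists U',
    portion X nU.2 -> nU.2 `<=` W -> step' nU.1 nU.2 U'.
  move=> [n U] /=.
  have [pU|] := pselect (portion X U /\ U `<=` W); last first.
    by move=> N; exists set0 => pU UW; exfalso; apply: N.
  have [[[i0 j0] ij0]|] := pselect (exists ij : I * nat, pickle ij = n); last first.
    have [i _ _] := XWA _ (conj Xx0 Wx0).
    move=> N; have [U' [pU' U'W U'U]] := step i 0%N U pU.1 pU.2.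
    exists U' => _ _; split => //; first exact: subset_trans U'U (@subDsetl _ _ _).
    by move=> i' j' ij; exfalso; apply: N; exists (i', j').
  have [U' [pU' U'W U'U]] := step i0 j0 U pU.1 pU.2.
  exists U' => _ _; split => //; first exact: subset_trans U'U (@subDsetl _ _ _).
  move=> i j ij; have : (i, j) = (i0, j0) by apply: (pcan_inj (@pickleK _)); rewrite ij.
  by move=> [-> ->]; apply/seteqP; split => // z [/U'U[]].
have [K Kx0 cK] := locally_compactT x0.
(* Starting inside the compact [K] yields a cluster point of points chosen in the [U n]; it lies in
   every [U n] because the closure of [U n.+1] does. *)
pose U := fix U n := if n is n'.+1 then G (n', U n') else W `&` K°.
have UP n : portion X (U n) /\ U n `<=` W.
  elim: n => [|n [pU UW]] /=.
    split; last by move=> ? [].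
    split; first by apply: openI => //; exact: open_interior.
    by exists x0; split => //; split.
  by have [] := GP (n, U n) pU UW.
have US n : closure (U n.+1) `<=` U n.
  by have [pU UW] := UP n; have [] := GP (n, U n) pU UW.
have Umono m n : (m <= n)%N -> U n `<=` U m.
  move=> /subnKC <-; elim: (n - m)%N => [|k IH]; first by rewrite addn0.
  by rewrite addnS; apply: subset_trans IH => z /subset_closure/US.
have /choice[x xP] : forall n, exists y, X y /\ U n y.
  by move=> n; have [[_ [y Xy]] _] := UP n; exists y.
have : (x @ \oo) K.
  by exists 0%N => // n _ /=; have [_ /(Umono 0%N)] := xP n; move=> /(_ isT) [_ /interior_subset].
move=> /cK[z [_ zc]].
have zcl (A' : set T) : (x @ \oo) A' -> closure A' z.
  by move=> xA N zN; exact: zc.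
have zU n : U n z.
  apply: US; apply: zcl; exists n.+1 => // k /= nk.
  exact: Umono nk _ (xP k).2.
have Xz : X z by apply: cX; apply: zcl; exists 0%N => // k _; exact: (xP k).1.
have [i _] : (\bigcup_i A i) z by apply: XWA; split=> //; exact: (UP 0%N).2.
rewrite (FP i).2 => -[j _ Fz].
have [pU UW] := UP (pickle (i, j)).
have [_ _ _ /(_ i j erefl)] := GP (pickle (i, j), _) pU UW.
 rewrite -subset0; apply; split; last exact: Fz.
by apply: subset_closure; exact: (zU (pickle (i, j)).+1).
Qed.

Variables (X : set T) (h : T -> R).
Hypothesis cX : closed X.
Hypothesis hF : forall A, Fsigma A -> Fsigma (h @^-1` A).

(** The closed intervals of radius [e] about the multiples of [e] cover the line; Baire picks one
    whose preimage contains a portion. *)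
Lemma portion_osc (e : R) (W : set T) : 0 < e -> portion X W ->
  exists W' c, [/\ portion X W', W' `<=` W &
     forall x, X x -> W' x -> `|h x - c| <= e].
Proof.
move=> e0 pW.
pose A (k : int) := h @^-1` [set t | (`|t - k%:~R * e| <= e)%R].
have AF k : Fsigma (A k).
  apply: hF; apply: closed_Fsigma.
  apply: (@closed_comp _ _ (fun t : R => `|t - k%:~R * e|) [set y | (y <= e)%R]); last exact: closed_le.
  by move=> t _; apply: cvg_norm; apply: cvgB; [exact: cvg_id|exact: cvg_cst].
have XWA : X `&` W `<=` \bigcup_k A k.
  move=> x _; exists (Num.floor (h x / e)) => //; rewrite /A/=.
  have := floor_itv (h x / e); rewrite ler_pdivlMr// ltr_pdivrMr// intrD mulrDl mul1r.
  by move=> /andP[? ?]; rewrite ler_norml; apply/andP; split; lra.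
have [k [W' [pW' W'W XW']]] := portion_Baire _ _ _ _ cX pW AF XWA.
by exists W', (k%:~R * e); split => // x Xx W'x; exact: XW'.
Qed.

(** * Points of strong discontinuity *)

Definition far (c r : R) (W : set T) : Prop :=
  forall x, X x -> W x -> r <= `|h x - c|.

Definition portion_accum (d : T) (P : set T -> Prop) : Prop :=
  forall N, nbhs d N -> exists W, [/\ portion X W, W `<=` N & P W].

Lemma portion_nbhs (d : T) (N : set T) : X d -> nbhs d N -> portion X N°.
Proof. by move=> Xd Nd; split; [exact: open_interior|exists d]. Qed.

(** Stronger than discontinuity at [d]: near [d] there are whole portions, which need not contain
    [d], on which [h] stays away from [h d]. *)
Definition exceptional (d : T) : Prop :=
  X d /\ exists2 r : R, 0 < r & portion_accum d (far (h d) r).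

Hypothesis discont : forall W, portion X W -> exists2 x, (X `&` W) x &
  exists2 e : R, 0 < e & forall N, nbhs x N -> exists y, [/\ X y, N y & e <= `|h y - h x|].

(** By [portion_osc], near a point [y] that is not exceptional there are portions on which [h] is
    close to [h y]. If such points [y] approach a discontinuity [x] while [h y] stays away from
    [h x], these portions make [x] exceptional. *)
Lemma exceptional_dense (W : set T) : portion X W -> exists2 d, W d & exceptional d.
Proof.
move=> pW; apply: contrapT => NW.
have typical y (e : R) : X y -> W y -> 0 < e ->
    portion_accum y (fun V => forall x, X x -> V x -> `|h x - h y| <= e).
  move=> Xy Wy e0 N yN; apply: contrapT => NV; apply: NW; exists y => //; split=> //.
  exists (e / 4); first by rewrite divr_gt0.
  move=> N' yN'.
  have pN : portion X ((N `&` N')°) by apply: (portion_nbhs y) => //; exact: filterI.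
  have e4 : 0 < e / 4 by rewrite divr_gt0.
  have [V [c [pV VN Vc]]] := portion_osc _ _ e4 pN.
  exists V; split => //; first by move=> z /VN/interior_subset[].
  have [x [Xx Vx hx]] : exists x, [/\ X x, V x & e < `|h x - h y|].
    apply: contrapT => Nx; apply: NV; exists V; split=> //.
      by move=> z /VN/interior_subset[].
    by move=> x Xx Vx; rewrite leNgt; apply/negP => ?; apply: Nx; exists x.
  move=> z Xz Vz; have := Vc _ Xx Vx; have := Vc _ Xz Vz; move: hx.
  rewrite !ler_norml lter_normr => /orP[] hx /andP[? ?] /andP[? ?].
    by rewrite ler_normr; apply/orP; left; lra.
  by rewrite ler_normr; apply/orP; right; lra.
have [x [Xx Wx] [e e0 xe]] := discont _ pW.
have e2 : 0 < e / 2 by rewrite divr_gt0.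
apply: NW; exists x => //; split=> //; exists (e / 2) => // N xN.
have [|y [Xy [/= Ny Wy] ye]] := xe (N° `&` W).
  apply: filterI; first by apply: open_nbhs_nbhs; split => //; exact: open_interior.
  by apply: open_nbhs_nbhs; split => //; exact: pW.1.
have [V [pV VN Vy]] := typical _ _ Xy Wy e2 _ Ny.
exists V; split=> // z Xz Vz; have := Vy _ Xz Vz.
move: ye; rewrite ler_norml !ler_normr => /orP[] ye /andP[? ?]; apply/orP; [left|right]; lra.
Qed.

(** If [d] takes an unwanted value [s], some portion near [d] keeps [h] away from [s], and the
    search resumes there. *)
Lemma exceptional_avoid (S : seq R) (W : set T) : portion X W ->
  exists d, [/\ W d, exceptional d & h d \notin S].
Proof.
elim: S W => [|s S IH] W pW.
  by have [d Wd dX] := exceptional_dense _ pW; exists d.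
have [d [Wd dX dS]] := IH _ pW.
have [ds|ds] := eqVneq (h d) s; last by exists d; split=> //; rewrite inE negb_or ds.
have [Xd [r r0 dr]] := dX.
have [|V [pV VW Vd]] := dr W; first by apply: open_nbhs_nbhs; split => //; exact: pW.1.
have [d' [Vd' d'X d'S]] := IH _ pV.
exists d'; split => //; first exact: VW.
rewrite inE negb_or d'S andbT -ds; apply/eqP => dd'.
by have := Vd _ d'X.1 Vd'; rewrite dd' subrr normr0 leNgt r0.
Qed.

Definition far_all (l : seq (T * R)) (W : set T) : Prop :=
  forall c, c \in l -> far (h c.1) c.2 W.

(** A pair [(d, r)] stands for the open ball of radius [r] about [h d]. The invariant: at each
    listed point accumulate portions that [h] maps off all listed balls at once. *)
Definition items (l : seq (T * R)) : Prop := forall c, c \in l ->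
  [/\ X c.1, 0 < c.2 & portion_accum c.1 (far_all l)].

Lemma far_sub (c r : R) (V W : set T) : V `<=` W -> far c r W -> far c r V.
Proof. by move=> VW cW x Xx /VW; exact: cW. Qed.

Lemma far_le (c r r' : R) (W : set T) : r' <= r -> far c r W -> far c r' W.
Proof. by move=> r'r cW x Xx Wx; apply: le_trans r'r _; exact: cW. Qed.

Lemma portion_accum_sub (d : T) (P Q : set T -> Prop) :
  (forall W, P W -> Q W) -> portion_accum d P -> portion_accum d Q.
Proof. by move=> PQ dP N /dP[W [pW WN /PQ QW]]; exists W. Qed.

(* A value that a new item must avoid, since every portion near [d] satisfying [P] contains points
   where [h] is close to it. There is at most one for each [d]. *)
Definition limit_value (d : T) (P : set T -> Prop) (w : R) : Prop :=
  forall r, 0 < r -> ~ portion_accum d (fun W => P W /\ far w r W).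

(** All portions near [d] with [P] would contain points with [h] near [w] and points with [h] near
    [w']; a subportion of small oscillation cannot do both. *)
Lemma limit_value_uniq (d : T) (P : set T -> Prop) (w w' : R) :
  (forall V W, V `<=` W -> P W -> P V) ->
  portion_accum d P -> limit_value d P w -> limit_value d P w' -> w = w'.
Proof.
move=> PS dP dw dw'; apply: contrapT => /eqP ww'.
have r0 : 0 < `|w - w'| / 4 by rewrite divr_gt0// normr_gt0 subr_eq0.
have : exists2 N, nbhs d N & forall W, portion X W -> W `<=` N -> P W ->
    ~ far w (`|w - w'| / 4) W.
  apply: contrapT => NN; apply: (dw _ r0) => N dN; apply: contrapT => NW.
  by apply: NN; exists N => // W pW WN PW Wf; apply: NW; exists W.
move=> [N dN NP].
have : exists2 N, nbhs d N & forall W, portion X W -> W `<=` N -> P W ->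
    ~ far w' (`|w - w'| / 4) W.
  apply: contrapT => NN; apply: (dw' _ r0) => N' dN'; apply: contrapT => NW.
  by apply: NN; exists N' => // W pW WN PW Wf; apply: NW; exists W.
move=> [N' dN' NP'].
have [W [pW WN PW]] := dP _ (filterI dN dN').
have [V [c [pV VW Vc]]] := portion_osc _ _ r0 pW.
have close u : ~ far u (`|w - w'| / 4) V -> `|c - u| < `|w - w'| / 2.
  move=> /existsNP[x /not_implyP[Xx /not_implyP[Vx /negP]]].
  rewrite -ltNge => ux; have := Vc _ Xx Vx.
  rewrite distrC => cx; rewrite -(subrKA (h x)).
  by apply: le_lt_trans (ler_normD _ _) _; lra.
have := close w (NP _ pV (fun z Vz => (WN z (VW z Vz)).1) (PS _ _ VW PW)).
have := close w' (NP' _ pV (fun z Vz => (WN z (VW z Vz)).2) (PS _ _ VW PW)).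
move=> c1 c2; suff : `|w - w'| < `|w - w'| by rewrite ltxx.
rewrite -{1}(subrKA c); apply: le_lt_trans (ler_normD _ _) _.
by rewrite (distrC w c); lra.
Qed.

(** The new point is an exceptional one avoiding the finitely many limit values of the old items.
    Each old item then tolerates some radius about [h d], and the new radius is the least of these
    and of the one that [d] itself provides. *)
Lemma items_rcons (l : seq (T * R)) (i : T * R) (N : set T) :
  items l -> i \in l -> nbhs i.1 N ->
  exists c W, [/\ portion X W, W `<=` N, W c.1, far_all l W & items (rcons l c)].
Proof.
move=> il li iN.
have [_ _ /(_ N iN)[W [pW WN lW]]] := il i li.
have farS V V' : V `<=` V' -> far_all l V' -> far_all l V.
  by move=> VV' lV' c lc; exact: far_sub VV' (lV' _ lc).
have /choice[b bP] : forall c : T * R, exists w, c \in l ->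
    forall w', limit_value c.1 (far_all l) w' -> w' = w.
  move=> c; have [[w cw]|Nw] := pselect (exists w, limit_value c.1 (far_all l) w).
    exists w => lc w' cw'; have [_ _ cl] := il c lc.
    exact: limit_value_uniq farS cl cw' cw.
  by exists 0 => _ w' cw'; exfalso; apply: Nw; exists w'.
have [d [Wd [Xd [r0 r00 dr0]] dl]] := exceptional_avoid (map b l) _ pW.
have /choice[g gP] : forall c : T * R, exists r, 0 < r /\ (c \in l ->
    portion_accum c.1 (fun W => far_all l W /\ far (h d) r W)).
  move=> c; have [lc|_] := boolP (c \in l); last by exists 1.
  apply: contrapT => Nr; move/negP: dl; apply.
  suff -> : h d = b c by exact: map_f.
  by apply: bP => // r r_gt0 cr; apply: Nr; exists r.
have [r [r_gt0 rr0 rg]] : exists r, [/\ 0 < r, r <= r0 & forall c, c \in l -> r <= g c].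
  elim: (l) => [|c s [r [r_gt0 rr0 rs]]]; first by exists r0.
  exists (Num.min r (g c)); split.
  - by rewrite lt_min r_gt0 (gP c).1.
  - by rewrite ge_min rr0.
  - move=> c'; rewrite inE ge_min => /orP[/eqP ->|/rs ->//].
    by rewrite lexx orbT.
exists (d, r), W; split => //.
have farR V : far_all l V -> far (h d) r V -> far_all (rcons l (d, r)) V.
  by move=> lV dV c; rewrite mem_rcons inE => /orP[/eqP ->//|]; exact: lV.
move=> c; rewrite mem_rcons inE => /orP[/eqP -> /=|lc].
  split=> // N' dN'.
  have [|V [pV VN' dV]] := dr0 (N' `&` W).
    by apply: filterI => //; apply: open_nbhs_nbhs; split => //; exact: pW.1.
  exists V; split => //; first by move=> z /VN'[].
  apply: farR; last exact: far_le rr0 dV.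
  by apply: farS lW => z /VN'[].
have [Xc c0 _] := il c lc; split => //.
apply: portion_accum_sub ((gP c).2 lc) => V [lV cV].
by apply: farR => //; exact: far_le (rg _ lc) cV.
Qed.

(** Every value is taken infinitely often and [parent n <= n]: each new item is placed near an
    earlier one, and each item gets others arbitrarily close to it. *)
Let parent (n : nat) : nat := logn 2 n.+1.

Let parent_le (n : nat) : (parent n <= n)%N.
Proof. by rewrite -ltnS; exact: ltn_logl. Qed.

Let parent_inf (j m : nat) : exists2 n, (m <= n)%N & parent n = j.
Proof.
have e0 : (0 < 2 ^ j * (2 * m).+1)%N by rewrite muln_gt0 expn_gt0.
exists (2 ^ j * (2 * m).+1).-1; rewrite /parent ?prednK//.
  rewrite -ltnS prednK//; apply: (@leq_trans (2 * m).+1).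
    by rewrite ltnS leq_pmull.
  by rewrite leq_pmull// expn_gt0.
rewrite lognM ?expn_gt0// pfactorK// -[RHS]addn0; congr (_ + _)%N.
by apply: logn_coprime; rewrite coprime2n /= oddM.
Qed.

(* For V the union of the balls (h d_n, r_n), the points d_n lie in the preimage of V and are dense
   in their closure E, while the points of E lying in infinitely many W_n form a dense G_delta of E
   outside the preimage of V. The complement of that preimage is F_sigma, so one of its closed parts
   contains a portion of E, hence some d_n: a contradiction. *)
Lemma discont_False : X !=set0 -> False.
Proof.
move=> X0.
have pX : portion X setT by split; [exact: openT|rewrite setIT].
have [d0 _ [Xd0 [r0 r00 d0r]]] := exceptional_dense _ pX.
have /choice[G GP] : forall nl : nat * seq (T * R), exists cW : (T * R) * set T,
    items nl.2 -> (parent nl.1 < size nl.2)%N ->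
    let i := nth (d0, r0) nl.2 (parent nl.1) in
    [/\ open cW.2, cW.2 `<=` ball i.1 nl.1.+1%:R^-1, cW.2 cW.1.1,
        far_all nl.2 cW.2 & items (rcons nl.2 cW.1)].
  move=> [n l]; have [[il ln]|] := pselect (items l /\ (parent n < size l)%N); last first.
    by move=> N; exists ((d0, r0), set0) => il ln; exfalso; apply: N.
  have [|c [W [pW WN Wc lW ilc]]] := items_rcons _ _
     (ball (nth (d0, r0) l (parent n)).1 n.+1%:R^-1) il (mem_nth (d0, r0) ln).
    exact: nbhsx_ballx.
  by exists (c, W) => _ _; split => //; exact: pW.1.
pose L := fix L n := if n is n'.+1 then rcons (L n') (G (n', L n')).1 else [:: (d0, r0)].
have LP n : items (L n) /\ size (L n) = n.+1.
  elim: n => [|n [iL sL]] /=.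
    split=> // c; rewrite inE => /eqP -> /=; split => //.
    by apply: portion_accum_sub d0r => W Wd c'; rewrite inE => /eqP ->.
  rewrite size_rcons sL; split => //.
  by have [] := GP (n, L n) iL; rewrite ?sL ?ltnS ?parent_le.
pose it n := nth (d0, r0) (L n) n.
have itE n k : (n <= k)%N -> nth (d0, r0) (L k) n = it n.
  move=> /subnKC <-; elim: (k - n)%N => [|m IH]; first by rewrite addn0.
  by rewrite addnS /= nth_rcons (LP (n + m)%N).2 ltnS leq_addr.
have itL n k : (n <= k)%N -> it n \in L k.
  by move=> nk; rewrite -(itE _ _ nk) mem_nth// (LP k).2.
pose d n := (it n).1; pose r n := (it n).2.
have [Xd r_gt0] : (forall n, X (d n)) /\ (forall n, 0 < r n).
  by split=> n; have [] := (LP n).1 _ (itL n n (leqnn n)).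
pose W n := (G (n, L n)).2.
have WP n : [/\ open (W n), W n `<=` ball (d (parent n)) n.+1%:R^-1,
    W n (d n.+1) & forall k, (k <= n)%N -> far (h (d k)) (r k) (W n)].
  have [iL sL] := LP n; have := GP (n, L n) iL.
  rewrite /= sL ltnS parent_le itE ?parent_le// => /(_ isT)[oW Wb Wd Wf _].
  rewrite /d; have <- : (G (n, L n)).1 = it n.+1 by rewrite /it /= nth_rcons sL ltnn eqxx.
  by split => // k kn; exact: Wf (itL _ _ kn).
pose V : set R := \bigcup_n ball (h (d n)) (r n).
have oV : open V by apply: bigcup_open => n _; exact: ball_open.
pose E := closure (range d).
have EX : E `<=` X.
  rewrite (closure_id X).1//; apply: closure_subset => _ [n _ <-]; exact: Xd.
pose O i := \bigcup_(n in [set n | (i <= n)%N]) W n.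
have oO i : open (O i) by apply: bigcup_open => n _; have [] := WP n.
have EO i : forall U, portion E U -> exists n, U (d n) /\ O i (d n).
  move=> U [oU [e [Ee Ue]]].
  have [|_ [[j _ <-] Uj]] := Ee U; first exact: open_nbhs_nbhs.
  have /nbhs_ballP[eps /= eps0 Ub] : nbhs (d j) U by exact: open_nbhs_nbhs.
  have [m me] := exists_natSinv_lt _ _ eps0.
  have [n mn nj] := parent_inf j (maxn m i); move: mn; rewrite geq_max => /andP[mn ni].
  have [_ Wb Wd _] := WP n.
  exists n.+1; split; last by exists n.
  rewrite nj in Wb; apply: Ub.
  have ne : n.+1%:R^-1 <= eps.
    by apply: ltW; apply: le_lt_trans me; rewrite lef_pV2 ?posrE// ler_nat.
  exact: le_ball ne _ (Wb _ Wd).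
(* A point of [E] in all [O i] lies in [W n] for arbitrarily large [n], so [h] maps it off every
   ball; it falls under [None]. *)
pose A (o : option nat) := if o is Some i then E `\` O i else h @^-1` (~` V).
have AF o : Fsigma (A o).
  case: o => [i|] /=.
    by apply: closed_Fsigma; apply: closedI; [exact: closed_closure|exact: open_closedC].
  by apply: hF; apply: closed_Fsigma; exact: open_closedC.
have EA : E `&` setT `<=` \bigcup_o A o.
  move=> e [Ee _]; have [eO|] := pselect (forall i, O i e); last first.
    by move=> /existsNP[i eOi]; exists (Some i).
  exists None => // -[j _ /= je]; have [n /= jn We] := eO j.
  have [_ _ _ /(_ j jn e (EX _ Ee) We)] := WP n.
  by move: je; rewrite /ball/= distrC ltNge => /negP.
have pE : portion E setT.
  split; first exact: openT.
  by exists (d 0%N); split => //; apply: subset_closure; exists 0%N.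
have [[i|] [U [pU _ UA]]] := portion_Baire _ _ _ _ (@closed_closure _ _) pE AF EA.
  have [n [Un On]] := EO i _ pU.
  by have [|_] := UA (d n); first by split => //; apply: subset_closure; exists n.
have [n [Un _]] := EO 0%N _ pU.
have [|/=] := UA (d n); first by split => //; apply: subset_closure; exists n.
by exists n => //; exact: ballxx.
Qed.

End portions.

Lemma continuity_portion (R : realType) (T : pseudoMetricType R) (X : set T) (h : T -> R) :
  (forall x : T, exists2 K, nbhs x K & compact K) -> closed X -> X !=set0 ->
  (forall A, Fsigma A -> Fsigma (h @^-1` A)) ->
  exists2 W, portion R T X W & forall x, X x -> W x -> forall e : R, 0 < e ->
    exists2 N, nbhs x N & forall y, X y -> N y -> `|h y - h x| < e.
Proof.
move=> lcT cX X0 hF; apply: contrapT => NW.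
apply: (discont_False R T lcT X h cX hF) => // W pW.
apply: contrapT => Nx; apply: NW; exists W => // x Xx Wx e e0.
apply: contrapT => NN; apply: Nx; exists x => //; exists e => // N xN.
apply: contrapT => Ny; apply: NN; exists N => // y Xy Ny'.
by rewrite ltNge; apply/negP => ey; apply: Ny; exists y.
Qed.

(** * Zigzags *)

Section zigzag.
Context (R : realType).
Implicit Types (v w s t : R) (i j N : int).

(** Both shapes go from 0 to 4 over [0, 8], so that cells glue. The one with a dip takes the values
    0, 3, 1, 4 at 0, 3, 5, 8. *)
Definition tooth (flat : bool) (s : R) : R :=
  if flat then s / 2 else if s <= 3 then s else if s <= 5 then 6 - s else s - 4.

(* Climbs by 4 over each cell [8i, 8i + 8], with a dip from 3 to 1 on the way unless p divides i. *)
Definition zigzag (p : nat) (v : R) : R :=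
  let i := Num.floor (v / 8) in 4 * i%:~R + tooth (p%:Z %| i)%Z (v - 8 * i%:~R).

Lemma tooth_ge0 (b : bool) s : 0 <= s -> 0 <= tooth b s.
Proof. by rewrite /tooth => ?; do 3?case: ifP; lra. Qed.

Lemma tooth_lt4 (b : bool) s : s < 8 -> tooth b s < 4.
Proof. by rewrite /tooth => ?; do 3?case: ifP; lra. Qed.

Lemma tooth_le (b : bool) s : 0 <= s -> tooth b s <= s.
Proof. by rewrite /tooth => ?; do 3?case: ifP; lra. Qed.

Lemma tooth_ge (b : bool) s : s < 8 -> s - 4 <= tooth b s.
Proof. by rewrite /tooth => ?; do 3?case: ifP; lra. Qed.

Lemma floor_eq (x : R) (m : int) : m%:~R <= x < m%:~R + 1 -> Num.floor x = m.
Proof. by move=> xm; apply: floor_def; rewrite intrD. Qed.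

Lemma zigzagE p v i : 8 * i%:~R <= v <= 8 * i%:~R + 8 ->
  zigzag p v = 4 * i%:~R + tooth (p%:Z %| i)%Z (v - 8 * i%:~R).
Proof.
move=> /andP[iv]; rewrite le_eqVlt => /orP[/eqP ve|vi]; last first.
  rewrite /zigzag; suff -> : Num.floor (v / 8) = i by [].
  by apply: floor_eq; apply/andP; split; lra.
rewrite /zigzag; suff -> : Num.floor (v / 8) = i + 1.
  by rewrite intrD /tooth; do 6?case: ifP; lra.
by apply: floor_eq; rewrite intrD; apply/andP; split; lra.
Qed.

Lemma cellP v : exists i, 8 * i%:~R <= v < 8 * i%:~R + 8.
Proof.
exists (Num.floor (v / 8)); have := floor_itv (v / 8).
by rewrite intrD => /andP[? ?]; apply/andP; split; lra.
Qed.

Lemma zigzag_cell p v : exists i s,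
  [/\ v = 8 * i%:~R + s, 0 <= s < 8 & zigzag p v = 4 * i%:~R + tooth (p%:Z %| i)%Z s].
Proof.
have [i /andP[iv vi]] := cellP v; exists i, (v - 8 * i%:~R); split.
- lra.
- apply/andP; split; lra.
- by rewrite (@zigzagE p v i)//; apply/andP; split; lra.
Qed.

(** The values over the half-open cell [i] stay in [4i, 4i + 4), so the height of a value determines
    its cell. *)
Lemma zigzag_lt p v i : v < 8 * i%:~R -> zigzag p v < 4 * i%:~R.
Proof.
have [j [s [-> /andP[s0 s8] ->]]] := zigzag_cell p v => vi.
have ji : (j < i)%R by rewrite -(@ltr_int R); lra.
have : j%:~R + 1 <= i%:~R :> R by rewrite -[1]/(1%:~R) -intrD ler_int; lia.
by have := tooth_lt4 (p%:Z %| j)%Z _ s8; lra.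
Qed.

Lemma zigzag_ge p v i : 8 * i%:~R <= v -> 4 * i%:~R <= zigzag p v.
Proof.
have [j [s [-> /andP[s0 s8] ->]]] := zigzag_cell p v => vi.
have ji : (i < j + 1)%R by rewrite -(@ltr_int R) intrD; lra.
have : i%:~R <= j%:~R :> R by rewrite ler_int; lia.
by have := tooth_ge0 (p%:Z %| j)%Z _ s0; lra.
Qed.

Lemma zigzag_node p i : zigzag p (8 * i%:~R) = 4 * i%:~R.
Proof.
rewrite (@zigzagE p _ i); last by apply/andP; split; lra.
by rewrite /tooth; do 3?case: ifP; lra.
Qed.

Lemma zigzag_flat2 p i : (p%:Z %| i)%Z -> zigzag p (8 * i%:~R + 2) = 4 * i%:~R + 1.
Proof.
move=> pi; rewrite (@zigzagE p _ i); last by apply/andP; split; lra.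
by rewrite pi /tooth; lra.
Qed.

Lemma zigzag_dip3 p i : ~~ (p%:Z %| i)%Z -> zigzag p (8 * i%:~R + 3) = 4 * i%:~R + 3.
Proof.
move=> /negbTE pi; rewrite (@zigzagE p _ i); last by apply/andP; split; lra.
by rewrite pi /tooth; do 3?case: ifP; lra.
Qed.

Lemma zigzag_dip5 p i : ~~ (p%:Z %| i)%Z -> zigzag p (8 * i%:~R + 5) = 4 * i%:~R + 1.
Proof.
move=> /negbTE pi; rewrite (@zigzagE p _ i); last by apply/andP; split; lra.
by rewrite pi /tooth; do 3?case: ifP; lra.
Qed.

(** Within a cell slopes are at most 1 in size; across cells, [tooth] lies between s - 4 and s, and
    the 4 lost is made up by the width 8 of a cell against its climb 4. *)
Lemma zigzag_lip p v w : v <= w -> `|zigzag p w - zigzag p v| <= w - v.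
Proof.
move=> vw.
have [i [s [ve /andP[s0 s8] ->]]] := zigzag_cell p v.
have [j [t [we /andP[t0 t8] ->]]] := zigzag_cell p w.
have ij : (i < j + 1)%R by rewrite -(@ltr_int R) intrD; lra.
have [eij|/eqP ij'] := eqVneq i j.
  subst j; move: ve we vw => -> -> vw; rewrite ler_norml /tooth.
  by apply/andP; split; do 5?case: ifP; lra.
have : i%:~R + 1 <= j%:~R :> R by rewrite -[1]/(1%:~R) -intrD ler_int; lia.
move=> ij1; rewrite ler_norml.
have := tooth_lt4 (p%:Z %| i)%Z _ s8; have := tooth_ge (p%:Z %| i)%Z _ s8.
have := tooth_ge0 (p%:Z %| j)%Z _ t0; have := tooth_le (p%:Z %| j)%Z _ t0.
by move=> *; apply/andP; split; lra.
Qed.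

Lemma zigzag_continuous p : continuous (zigzag p).
Proof.
move=> x; apply/cvgrPdist_lt => e e0; near=> y.
have xy : `|x - y| < e.
  by near: y; have /cvgrPdist_lt := @cvg_id _ (nbhs x); apply.
apply: le_lt_trans xy; have [xy|/ltW yx] := leP x y.
  by rewrite distrC [leRHS]distrC (ger0_norm (_ : 0 <= y - x)) ?subr_ge0// zigzag_lip.
by rewrite (ger0_norm (_ : 0 <= x - y)) ?subr_ge0// zigzag_lip.
Unshelve. all: by end_near.
Qed.

(** Breakpoints are integers with integer values and slopes are 1, -1 or 1/2, so no integer is
    crossed inside a unit interval. The list in the proof gives the floors over the eight unit
    pieces of a cell with a dip. *)
Lemma zigzag_unit p j : exists n, forall v, j%:~R < v < j%:~R + 1 ->
  Num.floor (zigzag p v) = n.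
Proof.
pose i := (j %/ 8)%Z.
have [r [r8 jr]] : exists r : nat, (r < 8)%N /\ j = 8 * i + r%:Z.
  have j0 : (0 <= j %% 8)%Z by rewrite modz_ge0.
  have j8 : (j %% 8 < 8)%Z by rewrite ltz_pmod.
  exists `|(j %% 8)%Z|%N; split; first lia.
  by rewrite {1}(divz_eq j 8) -/i; lia.
have jE : j%:~R = 8 * i%:~R + r%:R :> R by rewrite jr intrD intrM.
have E v : j%:~R < v < j%:~R + 1 ->
    zigzag p v = 4 * i%:~R + tooth (p%:Z %| i)%Z (v - 8 * i%:~R).
  move=> /andP[? ?]; apply: zigzagE.
  have : r%:R <= 7%:R :> R by rewrite ler_nat -ltnS.
  by have : 0 <= r%:R :> R by []; move=> ? ?; apply/andP; split; lra.
case: (boolP (p%:Z %| i)%Z) E => pi E.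
  exists (4 * i + (r./2)%:Z) => v vj; apply: floor_eq; rewrite (E _ vj) /tooth.
  rewrite intrD intrM.
  move: vj; rewrite jE; move: r8 {jr jE}; do 8?[case: r => [|r]] => //= _ /andP[? ?]; apply/andP; split; lra.
exists (4 * i + (nth 0%N [:: 0; 1; 2; 2; 1; 1; 2; 3]%N r)%:Z) => v vj.
apply: floor_eq; rewrite (E _ vj) /tooth intrD intrM.
move: vj; rewrite jE; move: r8 {jr jE}; do 8?[case: r => [|r]] => //= _ /andP[? ?];
  apply/andP; split; do 2?case: ifP; lra.
Qed.

(** The function decreases only along a dip, from relative height 3 to 1, so a fall of the floor by
    2 must start at the top of the dip of some cell [j]. *)
Lemma zigzag_drop p v w N : v <= w ->
  Num.floor (zigzag p v) = N + 2 -> Num.floor (zigzag p w) = N ->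
  exists2 j, N = 4 * j + 1 & ~~ (p%:Z %| j)%Z.
Proof.
move=> vw vN wN.
have := floor_itv (zigzag p v); have := floor_itv (zigzag p w).
rewrite vN wN !intrD => /andP[w1 w2] /andP[v1 v2].
have [i [s [ve /andP[s0 s8] vz]]] := zigzag_cell p v.
have [j [t [we /andP[t0 t8] wz]]] := zigzag_cell p w.
have ij : (i < j + 1)%R by rewrite -(@ltr_int R) intrD; lra.
have [ij'|/eqP ij'] := eqVneq i j; last first.
  have : i%:~R + 1 <= j%:~R :> R by rewrite -[1]/(1%:~R) -intrD ler_int; lia.
  move=> ij1; exfalso; have := tooth_lt4 (p%:Z %| i)%Z _ s8.
  by have := tooth_ge0 (p%:Z %| j)%Z _ t0; lra.
subst j; exists i; last first.
  by apply/negP => pi; move: vz wz; rewrite pi /tooth; lra.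
have /andP[N1 N2] : (4 * i < N < 4 * i + 2)%R.
  rewrite -!(@ltr_int R) !intrD intrM; apply/andP.
  by move: vz wz; rewrite /tooth; do 5?case: ifP; move=> *; split; lra.
lia.
Qed.

Definition odd_floor : set R := [set t | ~~ (2 %| Num.floor t)%Z].

Lemma Fsigma_floor (D : set int) : Fsigma [set t : R | D (Num.floor t)].
Proof.
suff -> : [set t : R | D (Num.floor t)] = \bigcup_(n in D)
    ([set t : R | n%:~R <= t] `&` [set t : R | t < n%:~R + 1]).
  apply: Fsigma_bigcup => n _; apply: Fsigma_setI.
    by apply: closed_Fsigma; apply: closed_ge.
  by apply: open_Fsigma; apply: open_lt.
apply/seteqP; split => [t Dt|t [n Dn [nt tn]]] /=.
  by exists (Num.floor t) => //; have := floor_itv t; rewrite intrD => /andP[].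
by rewrite (@floor_eq t n)//; apply/andP.
Qed.

(** Intervals [n, n + 1) are closed on the left only: nearby the floor may fall by one but cannot
    rise. Parity then tells the two cases apart. *)
Lemma floor_near (g : R -> R) (t : R) : {for t, continuous g} ->
  \forall u \near t, Num.floor (g u) = Num.floor (g t) \/
                     Num.floor (g u) = Num.floor (g t) - 1.
Proof.
move=> gt; have := floor_itv (g t); rewrite intrD; set n := Num.floor (g t) => /andP[ng gn].
have : \forall u \near t, (n - 1)%:~R < g u < (n + 1)%:~R.
  have d0 : 0 < Num.min 1 (n%:~R + 1 - g t) by rewrite lt_min ltr01 subr_gt0.
  move/cvgrPdist_lt : gt => /(_ _ d0); apply: filterS => u.
  rewrite lt_min => /andP[]; rewrite ltr_norml => /andP[_ u1]; rewrite distrC ltr_norml => /andP[_ u2].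
  by rewrite intrB intrD; apply/andP; split; lra.
apply: filterS => u; rewrite intrB intrD => /andP[u1 u2].
have [nu|un] := leP n%:~R (g u); [left|right].
  by apply: floor_eq; apply/andP.
by apply: floor_eq; rewrite intrB; apply/andP; split; lra.
Qed.

(* Crossing an integer changes the parity of the floor, so the two floors move together. *)
Lemma floor_lockstep (g h : R -> R) : continuous g -> continuous h ->
  (forall t, odd_floor (g t) <-> odd_floor (h t)) ->
  exists c, forall t, Num.floor (h t) = Num.floor (g t) + c.
Proof.
move=> cg ch gh; pose D t : R := (Num.floor (h t) - Num.floor (g t))%:~R.
have Dnear t : \forall u \near t, D u = D t.
  have := floor_near _ _ (cg t); have := floor_near _ _ (ch t).
  apply: filterS2 => u hu gu; rewrite /D; congr (_%:~R).
  have := gh u; have := gh t; rewrite /odd_floor /=.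
  move: hu gu; move: (Num.floor (g u)) (Num.floor (g t)) (Num.floor (h u)) (Num.floor (h t)).
  by move=> a b c d *; lia.
(* A locally constant function on the line has derivative zero, hence is constant. *)
have DC t : D t = D 0.
  apply: is_derive_0_is_cst => x.
  have Dx : {near x, cst (D x) =1 D} by apply: filterS (Dnear x) => u ->.
  apply: DeriveDef; first exact: near_eq_derivable Dx (derivable_cst _ _ _).
  by rewrite -(near_eq_derive _ Dx) derive_cst.
exists (Num.floor (h 0) - Num.floor (g 0)) => t.
have := DC t; rewrite /D => /intr_inj; lia.
Qed.

End zigzag.

Lemma clamp (R : realType) (a b : R) : a <= b -> exists c : R -> R,
  [/\ continuous c, forall t, a <= c t <= b & forall t, a <= t <= b -> c t = t].
Proof.
move=> ab; exists (fun t => Num.max a (Num.min b t)); split.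
- move=> t; apply: continuous_max; first exact: cvg_cst.
  by apply: continuous_min; [exact: cvg_cst|exact: cvg_id].
- by move=> t; rewrite le_max lexx /= ge_max ab ge_min lexx.
- by move=> t /andP[at_ tb]; rewrite min_r// max_r.
Qed.

Lemma IVT_up (R : realType) (f : R -> R) (a b v : R) : continuous f -> a <= b ->
  f a <= v -> v <= f b -> exists2 t, a <= t <= b & f t = v.
Proof.
move=> cf ab av vb.
have [|t] := @IVT R f a b v ab (continuous_subspaceT cf).
  by apply/andP; split; [rewrite ge_min av|rewrite le_max vb orbT].
by rewrite in_itv => /= tab <-; exists t.
Qed.

(* The image path must run down every dip of [zigzag q], which forces a drop by 2 of [zigzag p]. *)
Lemma zigzag_rigid (R : realType) (p q : nat) (a : int) (psi : R -> R) :
  (1 < p)%N -> (1 < q)%N -> (p%:Z %| a)%Z -> continuous psi ->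
  (forall v, 8 * a%:~R + 2 <= v <= 8 * (a + 2 * p%:Z + 1)%:~R ->
     odd_floor R (zigzag R p v) <-> odd_floor R (zigzag R q (psi v))) ->
  (q %| p)%N.
Proof.
set b := a + 2 * p%:Z + 1; set A : R := 8 * a%:~R + 2; set B : R := 8 * b%:~R.
move=> p1 q1 pa cpsi par.
have AB : A <= B.
  rewrite /A /B /b !intrD intrM; have : 0 <= p%:~R :> R by [].
  by lra.
have [cl [clc clin clid]] := clamp R A B AB.
have cg : continuous (zigzag R p \o cl).
  by move=> t; apply: continuous_comp; [exact: clc|exact: zigzag_continuous].
have ch : continuous (zigzag R q \o psi \o cl).
  move=> t; apply: continuous_comp; first exact: clc.
  by apply: continuous_comp; [exact: cpsi|exact: zigzag_continuous].
have [c cP] := floor_lockstep R _ _ cg ch (fun t => par (cl t) (clin t)).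
have {}cP v : A <= v <= B -> Num.floor (zigzag R q (psi v)) = Num.floor (zigzag R p v) + c.
  by move=> vAB; have := cP v; rewrite /= clid.
have zA : zigzag R q (psi A) < (4 * a + 2 + c)%:~R.
  have fA : Num.floor (zigzag R p A) = 4 * a + 1.
    by apply: floor_eq; rewrite zigzag_flat2// !intrD intrM; apply/andP; split; lra.
  have := floor_itv (zigzag R q (psi A)); rewrite cP ?lexx// fA => /andP[_].
  by rewrite (_ : _ + c + 1 = 4 * a + 2 + c)//; lia.
have zB : (4 * b + c)%:~R <= zigzag R q (psi B).
  have fB : Num.floor (zigzag R p B) = 4 * b.
    by apply: floor_eq; rewrite zigzag_node intrM; apply/andP; split; lra.
  by have := floor_itv (zigzag R q (psi B)); rewrite cP ?lexx ?AB// fB => /andP[].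
(* The end values [zA] and [zB] force [psi] to cross cell [i], so [zigzag q] meets height 4i + 3 and
   then 4i + 1. The floor of [zigzag p], which differs by [c], also falls by 2, in a cell [j]. *)
have key i : ~~ (q%:Z %| i)%Z -> 4 * a + 2 + c <= 4 * i -> 4 * i + 4 <= 4 * b + c ->
    exists2 j, c = 4 * (i - j) & ~~ (p%:Z %| j)%Z.
  move=> qi ai ib.
  have Ai : psi A < 8 * i%:~R.
    rewrite ltNge; apply/negP => /(zigzag_ge _ q).
    move: ai; rewrite -(@ler_int R) => ai zi.
    by have := lt_le_trans zA ai; rewrite intrM; lra.
  have iB : 8 * i%:~R + 8 <= psi B.
    rewrite leNgt; apply/negP => Bi.
    have : psi B < 8 * (i + 1)%:~R by rewrite intrD; lra.
    move=> /(zigzag_lt _ q); rewrite intrD => zi.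
    move: ib; rewrite -(@ler_int R) !intrD intrM => ib; move: zB; rewrite intrD intrM; lra.
  have [||t1 At1 t1i] := IVT_up R psi A B (8 * i%:~R + 3) cpsi AB; try lra.
  have /andP[At1' t1B] := At1.
  have [||t2 At2 t2i] := IVT_up R psi t1 B (8 * i%:~R + 5) cpsi t1B; try lra.
  have /andP[t12 t2B] := At2.
  have d3 : Num.floor (zigzag R q (psi t1)) = 4 * i + 3.
    by apply: floor_eq; rewrite t1i zigzag_dip3// intrD intrM; apply/andP; split; lra.
  have d5 : Num.floor (zigzag R q (psi t2)) = 4 * i + 1.
    by apply: floor_eq; rewrite t2i zigzag_dip5// intrD intrM; apply/andP; split; lra.
  have f1 := cP _ At1; rewrite d3 in f1.
  have f2 : Num.floor (zigzag R q (psi t2)) = Num.floor (zigzag R p t2) + c.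
    by apply: cP; rewrite t2B (le_trans At1').
  rewrite d5 in f2.
  have f1' : Num.floor (zigzag R p t1) = 4 * i + 1 - c + 2 by move: f1; clear; lia.
  have f2' : Num.floor (zigzag R p t2) = 4 * i + 1 - c by move: f2; clear; lia.
  have [j jE pj] := zigzag_drop R p t1 t2 _ t12 f1' f2'.
  by exists j => //; move: jE; clear; lia.
(* One of two consecutive integers is not divisible by [q], so [key] applies to some cell. *)
have [c' cE] : exists c', c = 4 * c'.
  have [i [qi i1 i2]] : exists i, [/\ ~~ (q%:Z %| i)%Z, 4 * a + 2 + c <= 4 * i &
      4 * i <= 4 * a + 9 + c].
    pose i := a + ((c + 5) %/ 4)%Z.
    have [i1 i2] : 4 * a + 2 + c <= 4 * i /\ 4 * i <= 4 * a + 5 + c.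
      rewrite /i; have := divz_eq (c + 5) 4; have := @modz_ge0 (c + 5) 4 isT.
      have := @ltz_pmod (c + 5) 4 isT.
      by move: (_ %/ _)%Z (_ %% _)%Z => u w *; lia.
    have [qi|qi] := boolP (q%:Z %| i)%Z; last by exists i; split => //; lia.
    exists (i + 1); split; [|lia|lia].
    by rewrite rpredDl//= dvdz1 /=; lia.
  have [||j -> _] := key i qi; [lia|rewrite /b; lia|].
  by exists (i - j).
(* A dip of [zigzag q] in cell [j + c'] would force one of [zigzag p] in cell [j], where [p] forbids
   it. This is applied to two multiples of [p] at distance [p]. *)
have mult j : (p%:Z %| j)%Z -> a + 1 <= j -> j + 1 <= b -> (q%:Z %| j + c')%Z.
  move=> pj aj jb; apply: contraT => qj.
  have [||i iE] := key _ qj.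
  - by move: aj cE; clear; lia.
  - by move: jb cE; clear; lia.
  - have -> : i = j by move: iE cE; clear; lia.
    by rewrite pj.
have m1 : (q%:Z %| a + p%:Z + c')%Z.
  by apply: mult; [rewrite rpredD ?dvdzz|move: p1; clear; lia|rewrite /b; lia].
have m2 : (q%:Z %| a + 2 * p%:Z + c')%Z.
  by apply: mult; [rewrite rpredD ?dvdz_mull|move: p1; clear; lia|rewrite /b; lia].
have : (q%:Z %| (a + 2 * p%:Z + c') - (a + p%:Z + c'))%Z by rewrite rpredB.
by have -> : a + 2 * p%:Z + c' - (a + p%:Z + c') = p by clear; lia.
Qed.

(** * Coded lines *)

Section digits.
Context (R : realType).
Implicit Types (a b : nat -> int) (i j m n : nat) (x y : set nat).

Definition digit_value a n : R := \sum_(i < n) (a i)%:~R / 5 ^+ i.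

Lemma digit_valueS a n :
  digit_value a n.+1 = (a 0%N)%:~R + digit_value (a \o succn) n / 5.
Proof.
rewrite /digit_value big_ord_recl expr0 divr1 mulr_suml; congr (_ + _).
by apply: eq_bigr => i _; rewrite /= exprSr invfM mulrA.
Qed.

Lemma digit_value_recr a n :
  digit_value a n.+1 = digit_value a n + (a n)%:~R / 5 ^+ n.
Proof. by rewrite /digit_value big_ord_recr. Qed.

Lemma eq_digit_value a b n : (forall i, (i < n)%N -> a i = b i) ->
  digit_value a n = digit_value b n.
Proof. by move=> ab; apply: eq_bigr => i _; rewrite ab. Qed.

Lemma digit_valueD a b n :
  digit_value (fun i => a i + b i) n = digit_value a n + digit_value b n.
Proof. by rewrite -big_split /=; apply: eq_bigr => i _; rewrite intrD mulrDl. Qed.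

Lemma digit_valueB a b n :
  digit_value (fun i => a i - b i) n = digit_value a n - digit_value b n.
Proof. by rewrite -sumrB; apply: eq_bigr => i _; rewrite intrB mulrBl. Qed.

Definition supported n a := forall i, (n <= i)%N -> a i = 0.

Lemma digit_value_supported n m a : (n <= m)%N -> supported n a ->
  digit_value a m = digit_value a n.
Proof.
move=> /subnKC <- an; elim: (m - n)%N => [|k IH]; first by rewrite addn0.
by rewrite addnS digit_value_recr IH an ?leq_addr// mul0r addr0.
Qed.

Lemma digit_value_le a n : (forall i, `|a i| <= 3) -> `|digit_value a n| <= 15 / 4.
Proof.
elim: n a => [|n IH] a a3.
  by rewrite /digit_value big_ord0 normr0; lra.
rewrite digit_valueS; have := IH (a \o succn) (fun i => a3 i.+1).
have : `|(a 0%N)%:~R| <= 3 :> R by rewrite -intr_norm -[3]/(3%:~R) ler_int.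
by rewrite !ler_norml => /andP[? ?] /andP[? ?]; apply/andP; split; lra.
Qed.

(** The digits after the first nonzero one contribute at most (15/4)/5 = 3/4 of 5^-j, which leaves
    1/4. The bound 3 allows for a digit in {-1, 0, 1} minus one of size at most 2. *)
Lemma digit_value_ge a j n : (forall i, `|a i| <= 3) -> (j < n)%N ->
  (forall i, (i < j)%N -> a i = 0) -> a j != 0 ->
  (5 ^+ j)^-1 / 4 <= `|digit_value a n|.
Proof.
elim: j n a => [|j IH] [|n] a a3 //= jn a0 aj.
  rewrite digit_valueS expr0 invr1.
  have := digit_value_le (a \o succn) n (fun i => a3 i.+1).
  have : 1 <= `|(a 0%N)%:~R| :> R.
    by rewrite -intr_norm -[1]/(1%:~R) ler_int; move: aj; clear; lia.
  rewrite ler_norml !ler_normr => /orP[] ? /andP[? ?]; apply/orP; [left|right]; lra.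
rewrite digit_valueS a0// add0r.
have := IH n (a \o succn) (fun i => a3 i.+1) jn (fun i ij => a0 i.+1 ij) aj.
rewrite normrM (ger0_norm (_ : 0 <= 5^-1))// exprSr invfM; lra.
Qed.

Lemma digit_sep a b n m j : (forall i, `|a i - b i| <= 3) ->
  supported n a -> supported m b ->
  `|digit_value a n - digit_value b m| < (5 ^+ j)^-1 / 4 ->
  forall i, (i <= j)%N -> a i = b i.
Proof.
move=> ab3 an bm; pose N := maxn n m.
rewrite -(@digit_value_supported n N) ?leq_maxl// -(@digit_value_supported m N) ?leq_maxr//.
rewrite -digit_valueB; move=> lt i ij; apply: contrapT => /eqP abi.
have ex : exists i, a i - b i != 0 by exists i; rewrite subr_eq0.
have [k kab kmin] := ex_minnP ex.
have kN : (k < N)%N.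
  rewrite ltnNge; apply/negP => Nk; move/eqP: kab; apply.
  by rewrite an ?bm ?subrr//; apply: leq_trans Nk; rewrite ?leq_maxl ?leq_maxr.
have kj : (k <= j)%N by apply: leq_trans ij; apply: kmin; rewrite subr_eq0.
have := digit_value_ge (fun i => a i - b i) k N ab3 kN _ kab.
have H : forall i, (i < k)%N -> a i - b i = 0.
  by move=> i' i'k; apply/eqP; apply: contraTT i'k => /kmin; rewrite -leqNgt.
move=> /(_ H); apply/negP; rewrite -ltNge; apply: lt_le_trans lt _.
by rewrite ler_pM2r ?invr_gt0// lef_pV2 ?posrE ?exprn_gt0// ler_weXn2l// ler1n.
Qed.

Definition active x i : Prop := ~~ odd i \/ x i./2.

Definition digits x m a := forall i, a i != 0 -> [/\ `|a i| = 1, active x i & (m <= i)%N].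

Lemma digits_norm x m a i : digits x m a -> `|a i| <= 1.
Proof. by move=> ax; have [->|/ax[->]] := eqVneq (a i) 0; rewrite ?normr0. Qed.

Lemma digits_sep x y m m' a b n n' j : digits x m a -> digits y m' b ->
  supported n a -> supported n' b ->
  `|digit_value a n - digit_value b n'| < (5 ^+ j)^-1 / 4 ->
  forall i, (i <= j)%N -> a i = b i.
Proof.
move=> ax bx; apply: digit_sep => i.
apply: le_trans (ler_normB _ _) _.
by have := digits_norm _ _ _ i ax; have := digits_norm _ _ _ i bx; lia.
Qed.

Lemma digits_inj x y m m' a b n n' : digits x m a -> digits y m' b ->
  supported n a -> supported n' b -> digit_value a n = digit_value b n' -> a =1 b.
Proof.
move=> ax bx an bn E i; apply: (digits_sep _ _ _ _ _ _ _ _ i ax bx an bn) => //.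
by rewrite E subrr normr0 divr_gt0// invr_gt0 exprn_gt0.
Qed.

(** [n] is the last nonzero position. The empty sum has none, so the line over 0 misses the code. *)
Definition code x a n := [/\ digits x 0 a, supported n.+1 a & a n != 0].

Lemma code_inj x y a b n n' : code x a n -> code y b n' ->
  digit_value a n.+1 = digit_value b n'.+1 -> a =1 b /\ n = n'.
Proof.
move=> [ax an an0] [bx bn bn0] E.
have ab := digits_inj _ _ _ _ _ _ _ _ ax bx an bn E; split => //.
have [nn'|nn'|//] := ltngtP n n'.
  by move: bn0; rewrite -ab an// eqxx.
by move: an0; rewrite ab bn// eqxx.
Qed.

(** [prime_above] returns some larger prime, so primes may be skipped; the sequence is strictly
    increasing, which gives distinctness and growth. *)
Fixpoint kth_prime k : nat := if k is k'.+1 then s2val (prime_above (kth_prime k')) else 2.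

Lemma prime_kth_prime k : prime (kth_prime k).
Proof. by case: k => [//|k] /=; case: prime_above. Qed.

Lemma kth_prime_lt k k' : (k < k')%N -> (kth_prime k < kth_prime k')%N.
Proof.
apply: (homo_ltn ltn_trans) => {}k /=.
by case: prime_above.
Qed.

Lemma kth_prime_inj k k' : kth_prime k = kth_prime k' -> k = k'.
Proof. by case: (ltngtP k k') => // /kth_prime_lt; lia. Qed.

Lemma kth_prime_gt k : (k < kth_prime k)%N.
Proof. by elim: k => [//|k IH]; have := kth_prime_lt k k.+1 (leqnn _); lia. Qed.

(* The factor p^2 makes the period 8p of the zigzag shrink to 8/p, so that every interval
   sees a full period of all but finitely many patterns. *)
Definition pattern n : set R :=
  if odd n then
    let p := kth_prime n./2 in [set v | odd_floor R (zigzag R p (p%:R ^+ 2 * v))]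
  else setT.

Definition plane_code x : set (R * R) :=
  [set u | exists a n, [/\ code x a n, u.1 = digit_value a n.+1 & pattern n u.2]].

Lemma pattern_continuous (p : nat) : continuous (fun v : R => zigzag R p (p%:R ^+ 2 * v)).
Proof.
move=> v; apply: (@continuous_comp _ _ _ (fun v : R => p%:R ^+ 2 * v)).
  exact: mulrl_continuous.
exact: zigzag_continuous.
Qed.

Lemma Fsigma_pattern n : Fsigma (pattern n).
Proof.
rewrite /pattern; case: ifP => _; last exact: FsigmaT.
apply: (Fsigma_preimage _ _ (fun v : R => zigzag R _ (_ * v)) (odd_floor R)).
  exact: pattern_continuous.
exact: (Fsigma_floor R [set z | ~~ (2 %| z)%Z]).
Qed.

Lemma Fsigma_patternC n : Fsigma (~` pattern n).
Proof.
rewrite /pattern; case: ifP => _; last by rewrite setCT; exact: Fsigma0.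
apply: (Fsigma_preimage _ _ (fun v : R => zigzag R _ (_ * v)) (~` odd_floor R)).
  exact: pattern_continuous.
exact: (Fsigma_floor R [set z | ~ ~~ (2 %| z)%Z]).
Qed.

Lemma Fsigma_line (u : R) (A : set R) : Fsigma A -> Fsigma [set q : R * R | q.1 = u /\ A q.2].
Proof.
move=> FA; apply: (@Fsigma_setI _ (fst @^-1` [set u]) (snd @^-1` A)).
  apply: Fsigma_preimage; first by move=> q; exact: cvg_fst.
  by apply: closed_Fsigma; exact: closed_eq.
by apply: Fsigma_preimage => // q; exact: cvg_snd.
Qed.

(** A code is a finite list of integers, so only countably many lines are involved. *)
Lemma Fsigma_plane_code x : Fsigma (plane_code x).
Proof.
suff -> : plane_code x = \bigcup_(sn in [set sn : seq int * nat | code x (nth 0 sn.1) sn.2])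
    [set q | q.1 = digit_value (nth 0 sn.1) sn.2.+1 /\ pattern sn.2 q.2].
  by apply: Fsigma_bigcup => sn _; apply: Fsigma_line; exact: Fsigma_pattern.
apply/seteqP; split => [[u v] [a [n [ax /= -> nv]]]|[u v] [[s n] /= sx [-> nv]]]; last first.
  by exists (nth 0 s), n.
have [s sa] : exists s, nth 0 s = a.
  exists (mkseq a n.+1); apply: funext => i.
  have [ni|ni] := leqP n.+1 i; last by rewrite nth_mkseq.
  by rewrite nth_default ?size_mkseq//; have [_ an _] := ax; rewrite an.
by exists (s, n) => /=; rewrite sa.
Qed.

(* The vertical section at u is a pattern or empty. *)
Lemma Fsigma_sectionC x u : Fsigma [set v | ~ plane_code x (u, v)].
Proof.
have [[a [n [ax ua]]]|N] := pselect (exists a n, code x a n /\ u = digit_value a n.+1).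
  suff -> : [set v | ~ plane_code x (u, v)] = ~` pattern n by exact: Fsigma_patternC.
  apply/seteqP; split=> v /= Nv; first by move=> nv; apply: Nv; exists a, n.
  move=> [b [n' [bx /= ub n'v]]]; apply: Nv.
  by have [_ ->] := code_inj _ _ _ _ _ _ ax bx (etrans (esym ua) ub).
suff -> : [set v | ~ plane_code x (u, v)] = setT by exact: FsigmaT.
by apply/seteqP; split=> v // _ [a [n [ax /= ua _]]]; apply: N; exists a, n.
Qed.

End digits.

(** * Reductions for almost inclusion *)

Section reduction.
Context (R : realType) (x y : set nat) (m : nat).
Hypothesis xy : forall i, (m <= i)%N -> active x i -> active y i.

Let tails : set R :=
  closure [set w | exists t n, [/\ digits x m t, supported n t & w = digit_value R t n]].

Let heads : set R :=
  [set e | exists a, [/\ digits x 0 a, supported m a & e = digit_value R a m]].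

Let heads_finite : finite_set heads.
Proof.
have [s sP] : exists s : seq R, forall a : nat -> int, (forall i, `|a i| <= 1) ->
    digit_value R a m \in s.
  elim: m => [|k [s sP]].
    by exists [:: 0] => a _; rewrite /digit_value big_ord0 inE.
  exists [seq u + c%:~R / 5 ^+ k | u <- s, c <- [:: -1; 0; 1 : int]] => a a1.
  rewrite digit_value_recr; apply: (allpairs_f (fun u c => u + c%:~R / 5 ^+ k)).
    exact: sP.
  by rewrite !inE; have := a1 k; lia.
apply: (sub_finite_set _ (finite_seq s)) => e [a [ax am ->]] /=.
by apply: sP => i; exact: digits_norm ax.
Qed.

Let tails_approx w (d : R) : tails w -> 0 < d ->
  exists t n, [/\ digits x m t, supported n t & `|w - digit_value R t n| < d].
Proof.
move=> wK d0; have [_ [[t [n [tx tn ->]]] wt]] := wK (ball w d) (nbhsx_ballx _ _ d0).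
by exists t, n.
Qed.

Let tails_digits t n : digits x m t -> supported n t -> tails (digit_value R t n).
Proof. by move=> tx tn; apply: subset_closure; exists t, n. Qed.

Let joinP a t n : digits x 0 a -> supported m a -> digits x m t -> supported n t ->
  let b i := a i + t i in
  [/\ digits x 0 b, supported (maxn m n) b &
      digit_value R b (maxn m n) = digit_value R a m + digit_value R t n].
Proof.
move=> ax am tx tn /=; split.
- move=> i; have [im|mi] := ltnP i m; last by rewrite am// add0r => /tx[].
  have -> : t i = 0.
    by apply/eqP; apply: contraTT im => /tx[_ _]; rewrite -leqNgt.
  by rewrite addr0; exact: ax.
- by move=> i; rewrite geq_max => /andP[mi ni]; rewrite am ?tn.
- rewrite digit_valueD (@digit_value_supported R m (maxn m n)) ?leq_maxl//.
  by rewrite (@digit_value_supported R n (maxn m n)) ?leq_maxr.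
Qed.

Let splitP a n : code x a n -> exists e t,
  [/\ heads e, digits x m t, supported n.+1 t, forall i, (m <= i)%N -> t i = a i &
      digit_value R a n.+1 = e + digit_value R t n.+1].
Proof.
move=> [ax an a0]; pose h i := if (i < m)%N then a i else 0.
pose t i := if (i < m)%N then 0 else a i.
have hx : digits x 0 h by move=> i; rewrite /h; case: ifP => [_ /ax//|]; rewrite eqxx.
have hm : supported m h by move=> i; rewrite /h leqNgt => /negbTE ->.
have tx : digits x m t.
  by move=> i; rewrite /t; case: ltnP => [|mi /ax[]//]; rewrite eqxx.
have tn : supported n.+1 t by move=> i ni; rewrite /t an// if_same.
have [_ _ E] := joinP _ _ _ hx hm tx tn.
exists (digit_value R h m), t; split=> //; first by exists h.
  by move=> i mi; rewrite /t ltnNge mi.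
rewrite -E -(@digit_value_supported R n.+1 (maxn m n.+1)) ?leq_maxr//.
by apply: eq_digit_value => i _; rewrite /h /t; case: ifP; rewrite ?addr0 ?add0r.
Qed.

(** Approximating both tails within 5^-m / 8 gives two digit sums closer than 5^-m / 4, which share
    all digits up to position [m]. *)
Let heads_uniq u e e' : heads e -> heads e' -> tails (u - e) -> tails (u - e') -> e = e'.
Proof.
move=> [a [ax am ->]] [b [bx bm ->]].
have d0 : 0 < (5 ^+ m)^-1 / 8 :> R by rewrite divr_gt0// invr_gt0 exprn_gt0.
move=> /tails_approx/(_ d0)[t [n [tx tn ut]]] /tails_approx/(_ d0)[s [k [sx sk us]]].
have [atx atn atE] := joinP _ _ _ ax am tx tn.
have [bsx bsk bsE] := joinP _ _ _ bx bm sx sk.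
have ab := digits_sep R _ _ _ _ _ _ _ _ m atx bsx atn bsk.
apply: eq_digit_value => i im.
have ti (r : nat -> int) : digits x m r -> r i = 0.
  by move=> rx; apply/eqP; apply: contraTT im => /rx[_ _]; rewrite -leqNgt.
have := ab _ i (ltnW im); rewrite (ti t)// (ti s)// !addr0; apply.
rewrite atE bsE; move: ut us; rewrite !ltr_norml => /andP[? ?] /andP[? ?].
by apply/andP; split; lra.
Qed.

(** The closure in [tails] adds no unwanted finite sums: each nonzero digit of [b] is also a digit
    of a close enough tail. *)
Let tails_code b n : digits y 0 b -> supported n b -> tails (digit_value R b n) -> digits x m b.
Proof.
move=> bx bn bK i bi.
have [|t [k [tx tk bt]]] := tails_approx _ ((5 ^+ i)^-1 / 4) bK.
  by rewrite divr_gt0// invr_gt0 exprn_gt0.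
have bti := digits_sep R _ _ _ _ _ _ _ _ i bx tx bn tk bt i (leqnn i).
by rewrite bti; apply: tx; rewrite -bti.
Qed.

Let tails0 : tails 0.
Proof.
have -> : 0 = digit_value R (fun=> 0) 0 by rewrite /digit_value big_ord0.
by apply: tails_digits => // i; rewrite eqxx.
Qed.

(* [u - e] is the value of the digits of [u] from position [m] on, when [e] carries the first [m]. *)
Let moved (u e : R) : Prop := [/\ heads e, tails (u - e) & u != e].

(** Where no head can be cut off, membership is decided by fiat: (1, 0) lies on a full line of the
    code of [y], and (0, 0) lies off it. The lines over the heads belong here, since cutting would
    send them to the line over 0. *)
Let shift (q : R * R) : R * R :=
  match pselect (exists e, moved q.1 e) with
  | left H => (q.1 - projT1 (cid H), q.2)
  | right _ => if `[< plane_code R x q >] then (1, 0) else (0, 0)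
  end.

Let shift_moved u v e : moved u e -> shift (u, v) = (u - e, v).
Proof.
move=> ue; rewrite /shift; case: pselect => [H|N] /=; last by exfalso; apply: N; exists e.
case: cid => e' /= [he' te' _]; have [he te _] := ue.
by rewrite (heads_uniq u _ _ he' he te' te).
Qed.

Let plane_code1 : plane_code R y (1, 0).
Proof.
exists (fun i => (i == 0%N)%:Z), 0%N; split => //=.
- by split=> // -[|i]//= _; split => //; left.
- by rewrite /digit_value big_ord_recl big_ord0 /= expr0 divr1 addr0.
Qed.

Let plane_code0 : ~ plane_code R y (0, 0).
Proof.
move=> [a [n [[ax an a0] /= E _]]].
have zx : digits y 0 (fun=> 0) by move=> i; rewrite eqxx.
have := digits_inj R _ _ _ _ _ _ _ 0%N ax zx an (fun _ _ => erefl).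
by rewrite -E /digit_value big_ord0 => /(_ erefl n) /eqP; apply/negP.
Qed.

Let shift_code q : plane_code R x q <-> plane_code R y (shift q).
Proof.
case: q => u v.
have [[e ue]|N] := pselect (exists e, moved u e); last first.
  rewrite /shift; case: pselect => //= _; case: asboolP => [xq|nxq].
    by split => // _; exact: plane_code1.
  by split => // /plane_code0.
rewrite (shift_moved _ _ _ ue); have [he te une] := ue; split.
  move=> [a [n [xa /= ua nv]]].
  have [e' [t [he' tx tn ta E]]] := splitP _ _ xa.
  have ee' : e' = e.
    by apply: (heads_uniq u) => //; rewrite ua E addrC addKr; exact: tails_digits.
  have ut : u - e = digit_value R t n.+1 by rewrite ua E ee' addrC addKr.
  have [_ _ a0] := xa.
  (* Otherwise the tail is empty and [u = e], which [moved] excludes. *)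
  have mn : (m <= n)%N.
    rewrite leqNgt; apply/negP => nm; move/eqP: une; apply; apply/eqP.
    rewrite -subr_eq0 ut; apply/eqP; apply: big1 => i _.
    have -> : t i = 0.
      apply/eqP; apply: contraTT (ltn_ord i) => /tx[_ _ mi].
      by rewrite -leqNgt; apply: leq_trans mi.
    by rewrite mul0r.
  exists t, n; split => //; split => //; last by rewrite ta.
  by move=> i /tx[? ? mi]; split => //; exact: xy.
move=> [b [n [[bx bn b0] /= ub nv]]].
have bt : digits x m b by apply: (tails_code b n.+1) => //; rewrite -ub.
have [_ _ mn] := bt _ b0.
have [a [ax am ea]] := he.
have [abx abn E] := joinP _ _ _ ax am bt bn.
rewrite (maxn_idPr _) in abn E; last exact: leqW.
exists (fun i => a i + b i), n; split => //=.
  by split => //; rewrite am// add0r.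
by rewrite E -ea -ub addrC subrK.
Qed.

Let rest_head u e : ~ (exists e, moved u e) -> heads e -> tails (u - e) -> u = e.
Proof.
by move=> N he te; apply/eqP; apply: contra_notT N => ue; exists e.
Qed.

Let head_rest u : heads u -> ~ (exists e, moved u e).
Proof.
move=> hu [e [he te ue]]; move/eqP: ue; apply.
by apply: (heads_uniq u) => //; rewrite subrr; exact: tails0.
Qed.

Let code_head u v : plane_code R x (u, v) -> exists2 e, heads e & tails (u - e).
Proof.
move=> [a [n [xa /= -> _]]]; have [e [t [he tx tn _ ->]]] := splitP _ _ xa.
by exists e => //; rewrite addrC addKr; exact: tails_digits.
Qed.

Let shift_rest u v : ~ (exists e, moved u e) ->
  shift (u, v) = if `[< plane_code R x (u, v) >] then (1, 0) else (0, 0).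
Proof. by move=> N; rewrite /shift; case: pselect. Qed.

(** On finitely many pieces, each closed meets open, the map is a translation. Elsewhere it is
    constant on the code and off it: the code part sits on the finitely many lines over heads, and
    the rest is an open set plus the sections of the complement on those lines. *)
Let shift_D2 : D2_fun shift.
Proof.
move=> A FA.
have FI (P : Prop) (S : set (R * R)) : Fsigma S -> Fsigma [set q | P /\ S q].
  move=> FS; have [p|np] := pselect P.
    suff -> : [set q | P /\ S q] = S by [].
    by apply/seteqP; split => // q [].
  suff -> : [set q | P /\ S q] = set0 by exact: Fsigma0.
  by apply/seteqP; split => // q [].
have c1 (e : R) : continuous (fun q : R * R => q.1 - e).
  by move=> q; apply: cvgB; [exact: cvg_fst|exact: cvg_cst].
have clK (e : R) : closed [set q : R * R | tails (q.1 - e)].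
  by move/continuous_closedP: (c1 e) => /(_ tails); apply; exact: closed_closure.
have opN (e : R) : open [set q : R * R | q.1 != e].
  have cf : continuous (fst : R * R -> R) by move=> q; exact: cvg_fst.
  by move/continuousP: cf => /(_ [set u | u != e]); apply; exact: open_neq.
have -> : shift @^-1` A =
   (\bigcup_(e in heads) ([set q | tails (q.1 - e)] `&` [set q | q.1 != e]
      `&` [set q | A (q.1 - e, q.2)]))
   `|` [set q | A (1, 0) /\ (\bigcup_(e in heads) [set q | q.1 = e /\ setT q.2] `&` plane_code R x) q]
   `|` [set q | A (0, 0) /\ ([set q : R * R | forall e, heads e -> ~ tails (q.1 - e)] `|`
       \bigcup_(e in heads) [set q | q.1 = e /\ [set v | ~ plane_code R x (e, v)] q.2]) q].
  apply/seteqP; split => [[u v] /= Aq|[u v] /=].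
    have [[e ue]|N] := pselect (exists e, moved u e).
      left; left; have [he te une] := ue; exists e => //; split => //=.
      by rewrite -(shift_moved _ _ _ ue).
    move: Aq; rewrite shift_rest//; case: asboolP => [xq A1|nxq A0].
      left; right; split => //; split => //=.
      have [e he te] := code_head _ _ xq.
      by exists e => //=; rewrite (rest_head _ _ N he te).
    right; split => //; have [[e [he te]]|Ne] := pselect (exists e, heads e /\ tails (u - e)).
      by right; exists e => //=; rewrite -(rest_head _ _ N he te).
    by left => e he te; apply: Ne; exists e.
  move=> [[[e he [[/= te une] Ae]]|[A1 [[e he [/= ue _]] xq]]]|[A0 H]].
  - by rewrite (shift_moved u v e).
  - by rewrite shift_rest; [case: asboolP|rewrite ue; exact: head_rest].
  - have N : ~ exists e, moved u e.
      case: H => [H [e [he te _]]|[e he [/= -> _]]]; first exact: (H e).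
      exact: head_rest.
    rewrite shift_rest//; case: asboolP => // xq; exfalso.
    case: H => [H|[e he [/= ue]]]; last by apply; rewrite -ue.
    by have [e he te] := code_head _ _ xq; exact: (H e).
apply: Fsigma_setU; first apply: Fsigma_setU.
- apply: Fsigma_finite => // e _; apply: Fsigma_setI; first apply: Fsigma_setI.
  + by apply: closed_Fsigma; exact: clK.
  + by apply: open_Fsigma; exact: opN.
  + apply: (Fsigma_preimage _ _ (fun q : R * R => (q.1 - e, q.2))) => // q.
    have cs : continuous (snd : R * R -> R) by move=> r; exact: cvg_snd.
    exact: (cvg_pair (c1 e q) (cs q)).
- apply: FI; apply: Fsigma_setI; last exact: Fsigma_plane_code.
  by apply: Fsigma_finite => // e _; apply: Fsigma_line; exact: FsigmaT.
- apply: FI; apply: Fsigma_setU.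
    apply: open_Fsigma.
    suff -> : [set q : R * R | forall e, heads e -> ~ tails (q.1 - e)] =
        ~` \bigcup_(e in heads) [set q : R * R | tails (q.1 - e)].
      by apply: closed_openC; apply: closed_bigcup => // e _; exact: clK.
    apply/seteqP; split => q /= H; first by move=> [e he /=]; exact: H.
    by move=> e he te; apply: H; exists e.
  by apply: Fsigma_finite => // e _; apply: Fsigma_line; exact: Fsigma_sectionC.
Qed.

Lemma D2_le_plane_code : D2_le (plane_code R x) (plane_code R y).
Proof. by exists shift => //; apply/seteqP; split => q /shift_code. Qed.

End reduction.

Lemma almost_subset_active (x y : set nat) : almost_subset x y ->
  exists m, forall i, (m <= i)%N -> active x i -> active y i.
Proof.
(* Position [i] belongs to the index [i./2], which from this bound on exceeds every element of the
   finite difference. *)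
move=> /finite_seqP[s sP]; exists (2 * (\max_(k <- s) k).+1)%N => i mi [|xi]; first by left.
right; apply: contrapT => nyi.
have /= si : [set` s] i./2 by rewrite -sP.
have := @leq_bigmax_seq _ s xpredT id _ si isT.
by have := odd_double_half i; move: mi; clear; move: (\max_(k <- s) k) => M /=; lia.
Qed.

(** * Rigidity of paths *)

Section rigidity.
Context (R : realType).

(** Appends a digit beyond the support. Size 1 at an active position yields a coded line, size 2 a
    line that misses the code. *)
Lemma digit_value_bump (b : nat -> int) n i (s : int) : supported n b -> (n <= i)%N ->
  digit_value R (fun j => b j + (if j == i then s else 0)) i.+1 =
  digit_value R b n + s%:~R / 5 ^+ i.
Proof.
move=> bn ni; rewrite digit_value_recr eqxx bn// add0r; congr (_ + _).
rewrite -(@digit_value_supported R n i)//; apply: eq_digit_value => j ji.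
by rewrite (ltn_eqF ji) addr0.
Qed.

Lemma supported_bump (b : nat -> int) n i (s : int) : supported n b -> (n <= i)%N ->
  supported i.+1 (fun j => b j + (if j == i then s else 0)).
Proof.
move=> bn ni j ij; rewrite bn ?(gtn_eqF ij)//.
exact: leq_trans ni (ltnW ij).
Qed.

Lemma code_bump (x : set nat) b n i (s : int) : digits x 0 b -> supported n b ->
  (n <= i)%N -> active x i -> `|s| = 1 ->
  code x (fun j => b j + (if j == i then s else 0)) i.
Proof.
move=> bx bn ni xi s1; split; last by rewrite eqxx bn// add0r -normr_eq0 s1.
  move=> j; case: (j =P i) => [->|_]; last by rewrite addr0 => /bx.
  by rewrite bn// add0r.
exact: (supported_bump _ _ _ _ bn ni).
Qed.

(** [s] is the direction in which [f] moves away from [f c]; the intermediate value theorem supplies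
    every small displacement on that side. *)
Lemma crossing (f : R -> R) (c v : R) : continuous f -> c <= v -> exists s : int,
  `|s| = 1 /\ forall z : R, 0 < z < `|f v - f c| -> exists2 t, c < t < v & f t = f c + s%:~R * z.
Proof.
move=> cf cv; wlog fcv : f cf / f c <= f v => [H|].
  have [|/ltW fvc] := leP (f c) (f v); first exact: H.
  have [|/=|s [s1 sP]] := H (fun t => - f t); [|by rewrite lerN2|].
    by move=> t; apply: cvgN; exact: cf.
  exists (- s); split; first by rewrite normrN.
  move=> z zf; have [|t ct ft] := sP z; first by rewrite -opprD normrN.
  by exists t => //; rewrite intrN mulNr; lra.
exists 1; split => // z; rewrite ger0_norm ?subr_ge0// mul1r => /andP[z0 zf].
have [||t /andP[ct tv] ft] := IVT_up R f c v (f c + z) cf cv; [lra|lra|].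
exists t => //; rewrite !lt_neqAle ct tv !andbT; apply/andP; split; apply/eqP => E.
  by move: ft; rewrite -E; lra.
by move: ft; rewrite E; lra.
Qed.

Lemma exists_even_exp (e : R) (n : nat) : 0 < e ->
  exists i, [/\ ~~ odd i, (n <= i)%N & 2 / 5 ^+ i < e].
Proof.
move=> e0; have e2 : 0 < e / 2 by rewrite divr_gt0.
have [N Ne] := exists_natSinv_lt _ _ e2.
exists (N + n).*2; rewrite odd_double; split => //; first by lia.
suff : (5 ^+ (N + n).*2)^-1 <= N.+1%:R^-1 :> R.
  by move: Ne; move: N.+1%:R^-1 (5 ^+ _)^-1 => u w; lra.
rewrite lef_pV2 ?posrE ?exprn_gt0// -natrX ler_nat.
by have := @ltn_expl 5 (N + n).*2 isT; lia.
Qed.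

(* The first coordinate cannot leave a coded line: on its way it would meet, at arbitrarily
   small scales, both a full line and a line that misses the code. *)
Lemma path_rigid (y : set nat) (k : nat) (a : int) (phi psi : R -> R) :
  let p := kth_prime k in
  (p%:Z %| a)%Z -> continuous phi -> continuous psi ->
  (forall v, 8 * a%:~R + 2 <= v <= 8 * (a + 2 * p%:Z + 1)%:~R ->
     odd_floor R (zigzag R p v) <-> plane_code R y (phi v, psi v)) -> y k.
Proof.
move=> p pa cphi cpsi; set A : R := 8 * a%:~R + 2; set B : R := 8 * _%:~R => phiP.
have pp : prime p by exact: prime_kth_prime.
have p1 := prime_gt1 pp.
have BE : B = A + (8 * (2 * p + 1) - 2)%:R.
  rewrite natrB; last by lia.
  by rewrite /A /B natrM natrD natrM !intrD intrM -!pmulrn; lra.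
have AB : A <= B by rewrite BE lerDl.
have AAB : A <= A <= B by rewrite lexx.
have oddA : odd_floor R (zigzag R p A).
  rewrite /odd_floor /= zigzag_flat2// (@floor_eq R _ (4 * a + 1)).
    by lia.
  by rewrite intrD intrM; apply/andP; split; lra.
have [b [n [by_ /= phiA _]]] := (phiP A AAB).1 oddA.
have [bx bn b0] := by_.
(* [A] is an integer, so inside each unit step of the induction the floor of [zigzag p] is constant
   by [zigzag_unit]. *)
have const (j : nat) : A + j%:R <= B -> forall v, A <= v <= A + j%:R -> phi v = phi A.
  elim: j => [_ v|j IH jB v /andP[Av vj]].
    by rewrite addr0 => vA; congr phi; apply/esym/eqP; rewrite eq_le.
  have j1 : j.+1%:R = j%:R + 1 :> R by rewrite -natr1.
  rewrite j1 in jB vj.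
  have {}IH : forall v, A <= v <= A + j%:R -> phi v = phi A by apply: IH; lra.
  have [vj'|/ltW jv] := leP v (A + j%:R); first by apply: IH; rewrite Av.
  have phij : phi (A + j%:R) = phi A by apply: IH; rewrite lexx lerDl ler0n.
  apply: contrapT => /eqP phiv.
  have [s [s1 sP]] := crossing phi _ _ cphi jv; rewrite phij in sP.
  have d0 : 0 < `|phi v - phi A| by rewrite normr_gt0 subr_eq0.
  have [i [ie ni id]] := exists_even_exp _ n.+1 d0.
  have [m mP] := zigzag_unit R p (8 * a + 2 + j%:Z).
  have {}mP t : A + j%:R < t < v -> Num.floor (zigzag R p t) = m.
    move=> /andP[jt tv]; apply: mP; rewrite !intrD intrM -pmulrn.
    by have := lt_le_trans tv vj; move: jt; rewrite /A => *; apply/andP; split; lra.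
  have i0 : 0 < (5 ^+ i)^-1 :> R by rewrite invr_gt0 exprn_gt0.
  have [|t1 t1v phi1] := sP (1 / 5 ^+ i); first by apply/andP; split; lra.
  have [|t2 t2v phi2] := sP (2 / 5 ^+ i); first by apply/andP; split; lra.
  have inAB t : A + j%:R < t < v -> A <= t <= B.
    by have := ler0n R j; move=> ? /andP[? ?]; apply/andP; split; lra.
  have C1 : plane_code R y (phi t1, psi t1).
    exists (fun j => b j + (if j == i then s else 0)), i; split => /=.
    - by apply: code_bump bx bn ni _ s1; left.
    - by rewrite (digit_value_bump _ n.+1)// phi1 phiA mul1r.
    - by rewrite /pattern (negbTE ie).
  (* The first coordinate is the value of [b] with the digit 2s appended at [i]; [digit_sep] would
     give any code of it that same digit, of size 2. *)
  have C2 : ~ plane_code R y (phi t2, psi t2).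
    move=> [c [n' [[cx cn' _] /= cE _]]].
    pose b' j := b j + (if j == i then s * 2 else 0).
    have b'2 l : `|b' l| <= 2.
      rewrite /b'; case: eqP => [->|_]; first by rewrite bn// add0r; move: s1; clear; lia.
      by rewrite addr0; apply: le_trans (digits_norm _ _ _ l bx) _.
    have cb l : `|c l - b' l| <= 3.
      by have := digits_norm _ _ _ l cx; have := b'2 l; clear; lia.
    have dist : `|digit_value R c n'.+1 - digit_value R b' i.+1| < (5 ^+ i)^-1 / 4.
      rewrite -cE (digit_value_bump _ n.+1)// phi2 phiA intrM mulrA subrr normr0.
      by rewrite divr_gt0.
    have b'i : supported i.+1 b' by exact: (supported_bump _ _ _ _ bn ni).
    have := digit_sep R _ _ _ _ _ cb cn' b'i dist i (leqnn i).
    rewrite /b' eqxx bn// add0r.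
    by have := digits_norm _ _ _ i cx; move: s1; clear; lia.
  apply: C2; apply/(phiP _ (inAB _ t2v)); move: ((phiP _ (inAB _ t1v)).2 C1).
  by rewrite /odd_floor /= !mP.
have {}const v : A <= v <= B -> phi v = phi A.
  by move: v; have := const (8 * (2 * p + 1) - 2)%N; rewrite -BE lexx => /(_ isT).
have patP v : A <= v <= B -> odd_floor R (zigzag R p v) <-> pattern R n (psi v).
  move=> vAB; rewrite phiP// const// phiA; split=> [[c [n' [cy /= E pat]]]|pat]; last by exists b, n.
  by have [_ ->] := code_inj R _ _ _ _ _ _ by_ cy E.
(* A full line would make the floor odd on all of [A, B], but at the node over 8(a + 1) it is 4(a +
   1). *)
have [on|en] := boolP (odd n); last first.
  have inAB : A <= 8 * (a + 1)%:~R <= B.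
    rewrite BE /A intrD; apply/andP; split; first lra.
    have : 6%:R <= (8 * (2 * p + 1) - 2)%:R :> R by rewrite ler_nat; lia.
    by lra.
  have := (patP _ inAB).2; rewrite /pattern (negbTE en) => /(_ I).
  rewrite /odd_floor /= zigzag_node (@floor_eq R _ (4 * (a + 1))).
    by clear; lia.
  by rewrite intrM; apply/andP; split; lra.
pose q := kth_prime n./2.
have pq : prime q by exact: prime_kth_prime.
have qp : (q %| p)%N.
  apply: (zigzag_rigid R p q a (fun v => q%:R ^+ 2 * psi v)) => //.
  - exact: prime_gt1.
  - by move=> v; apply: cvgM; [exact: cvg_cst|exact: cpsi].
  - by move=> v vAB; rewrite patP// /pattern on.
have /kth_prime_inj nk : kth_prime n./2 = kth_prime k.
  by apply/eqP; rewrite -dvdn_prime2.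
by have [_ [|]] := bx _ b0; rewrite ?on// nk.
Qed.

End rigidity.

(** * Reductions in the plane and almost inclusion *)

Lemma plane_locally_compact (R : realType) (q : R * R) : exists2 K, nbhs q K & compact K.
Proof.
exists (`[q.1 - 1, q.1 + 1] `*` `[q.2 - 1, q.2 + 1]); last first.
  by apply: compact_setX; exact: segment_compact.
exists (`[q.1 - 1, q.1 + 1]%classic, `[q.2 - 1, q.2 + 1]%classic) => //=; split.
  by exists 1 => //= z /=; rewrite in_itv /= ltr_distlC => /andP[? ?]; apply/andP; split; lra.
by exists 1 => //= z /=; rewrite in_itv /= ltr_distlC => /andP[? ?]; apply/andP; split; lra.
Qed.

(** One coordinate at a time: the second is treated on the closure of a smaller portion where the
    first is already continuous. *)
Lemma D2_continuity_portion (R : realType) (X : set (R * R)) (f : R * R -> R * R) :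
  closed X -> X !=set0 -> D2_fun f ->
  exists2 W, portion R (R * R)%type X W & forall q, X q -> W q -> forall e : R, 0 < e ->
    exists2 N, nbhs q N & forall r, X r -> N r ->
      `|(f r).1 - (f q).1| < e /\ `|(f r).2 - (f q).2| < e.
Proof.
move=> cX X0 D2f.
have [f1 f2] : (forall A, Fsigma A -> Fsigma ((fun q => (f q).1) @^-1` A)) /\
               (forall A, Fsigma A -> Fsigma ((fun q => (f q).2) @^-1` A)).
  split=> A FA.
    by apply: (D2f (fst @^-1` A)); apply: Fsigma_preimage => // q; exact: cvg_fst.
  by apply: (D2f (snd @^-1` A)); apply: Fsigma_preimage => // q; exact: cvg_snd.
have [W [oW [q [Xq Wq]]] W1] := continuity_portion _ _ _ _ (@plane_locally_compact R) cX X0 f1.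
have /uniform_regular[B qB BW] : nbhs q W by exact: open_nbhs_nbhs.
pose Y := closure (X `&` B°).
have YX : Y `<=` X.
  by rewrite (closure_id X).1//; apply: closure_subset => z [].
have Y0 : Y !=set0 by exists q; apply: subset_closure.
have [V [oV [r [Yr Vr]]] V2] :=
  continuity_portion _ _ _ _ (@plane_locally_compact R) (@closed_closure _ _) Y0 f2.
have BW' z : (B° ) z -> W z by move=> /interior_subset/subset_closure/BW.
exists (V `&` B°).
  split; first by apply: openI => //; exact: open_interior.
  have [|z [[Xz Bz] Vz]] := Yr V; first exact: open_nbhs_nbhs.
  by exists z.
move=> z Xz [Vz Bz] e e0.
have [N1 zN1 N1P] := W1 z Xz (BW' _ Bz) e e0.
have [|N2 zN2 N2P] := V2 z _ Vz e e0; first exact: subset_closure.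
exists (N1 `&` N2 `&` B°).
  by apply: filterI; [exact: filterI|apply: open_nbhs_nbhs; split => //; exact: open_interior].
move=> w Xw [[N1w N2w] Bw]; split; first exact: N1P.
by apply: N2P => //; exact: subset_closure.
Qed.

Lemma D2_le_almost_subset (R : realType) (x y : set nat) :
  D2_le (plane_code R x) (plane_code R y) -> almost_subset x y.
Proof.
move=> [f D2f fE].
pose V : set R := [set w | exists a n, [/\ digits x 0 a, supported n a & w = digit_value R a n]].
pose X : set (R * R) := fst @^-1` (closure V).
have cX : closed X.
  have cf : continuous (fst : R * R -> R) by move=> q; exact: cvg_fst.
  by move/continuous_closedP: cf; apply; exact: closed_closure.
have VX u v : V u -> X (u, v) by move=> Vu; exact: subset_closure.
have X0 : X !=set0.
  exists (0, 0); apply: VX; exists (fun=> 0), 0%N; split => //.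
  by rewrite /digit_value big_ord0.
have [W [oW [[u0 v0] [Xq Wq]]] WP] := D2_continuity_portion R X f cX X0 D2f.
have /nbhs_ballP[d /= d0 dW] : nbhs (u0, v0) W by exact: open_nbhs_nbhs.
have d2 : 0 < d / 2 by rewrite divr_gt0.
have [w [[a [n [ax an wE]]] uw]] := Xq (ball u0 (d / 2)) (nbhsx_ballx _ _ d2).
have [M Md] := exists_natSinv_lt _ _ d2.
have d24 : 0 < d / 24 by rewrite divr_gt0.
have [L Ld] := exists_natSinv_lt _ _ d24.
suff key k : (M <= k)%N -> (L <= k)%N -> (n <= k)%N -> x k -> y k.
  apply: (sub_finite_set _ (finite_II (M + L + n)%N)) => k [xk nyk] /=.
  by rewrite ltnNge; apply/negP => Hk; apply: nyk; apply: key => //; lia.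
move=> Mk Lk nk xk.
(* Appending the digit 1 at position 2k + 1 moves the line over [w] by less than d / 2 and places
   the [k]-th pattern on it. *)
pose i := k.*2.+1.
have xi : active x i by right; rewrite /i /= uphalf_double.
have ni : (n <= i)%N by rewrite /i; lia.
have qx := code_bump x a n i 1 ax an ni xi erefl.
set u := digit_value R (fun j => a j + (if j == i then 1 else 0)) i.+1.
have uE : u = w + 1 / 5 ^+ i by rewrite /u (digit_value_bump R _ n)// wE.
have ud : `|u0 - u| < d.
  have iM : (5 ^+ i)^-1 <= M.+1%:R^-1 :> R.
    rewrite lef_pV2 ?posrE ?exprn_gt0// -natrX ler_nat.
    by have := @ltn_expl 5 i isT; rewrite /i; lia.
  have i0 : 0 < (5 ^+ i)^-1 :> R by rewrite invr_gt0 exprn_gt0.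
  move: uw; rewrite uE /ball /= ltr_norml => /andP[? ?].
  rewrite div1r ltr_norml; move: iM i0 Md; move: (5 ^+ i)^-1 M.+1%:R^-1 => e1 e2 *.
  by apply/andP; split; lra.
have Vu : V u.
  by exists (fun j => a j + (if j == i then 1 else 0)), i.+1; split => //; have [] := qx.
have Wu t : `|v0 - t| < d -> W (u, t) by move=> td; apply: dW; split.
pose p := kth_prime k; pose c : R := p%:R ^+ 2.
have p0 : 0 < p%:R :> R by rewrite ltr0n prime_gt0// prime_kth_prime.
have c0 : 0 < c by rewrite exprn_gt0.
(* [b] is the multiple of [p] with 8b <= c v0 < 8b + 8p. As [A, B] lies in [8b, 8b + 24p], dividing
   by c = p^2 leaves it within 24 / p of [v0], whence the bound d / 24. *)
pose b : int := p%:Z * Num.floor (c * v0 / (8 * p%:R)).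
set A : R := 8 * b%:~R + 2; set B : R := 8 * (b + 2 * p%:Z + 1)%:~R.
have BE : B = 8 * b%:~R + 16 * p%:R + 8 by rewrite /B !intrD intrM -pmulrn; lra.
have p1 : 1 <= p%:R :> R by rewrite ler1n prime_gt0// prime_kth_prime.
have AB : A <= B by rewrite BE /A; lra.
have inW t : A <= t <= B -> `|v0 - t / c| < d.
  move=> /andP[At tB].
  have := floor_itv (c * v0 / (8 * p%:R)).
  rewrite ler_pdivlMr ?ltr_pdivrMr ?mulr_gt0// => /andP[b1 b2].
  have bE : b%:~R = p%:R * (Num.floor (c * v0 / (8 * p%:R)))%:~R :> R.
    by rewrite /b intrM -pmulrn.
  have pd : p%:R^-1 < d / 24.
    apply: le_lt_trans Ld; rewrite lef_pV2 ?posrE// ler_nat.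
    by have := kth_prime_gt k; rewrite -/p; lia.
  have : `|c * v0 - t| < c * d.
    have pp : 24 * p%:R < c * d.
      rewrite /c expr2 -mulrA [24 * _]mulrC ltr_pM2l//.
      by move: pd; rewrite -(ltr_pM2l p0) mulfV ?gt_eqF//; lra.
    rewrite intrD in b2; move: At tB; rewrite BE /A bE => At tB.
    by rewrite ltr_norml; apply/andP; split; nra.
  have -> : c * v0 - t = c * (v0 - t / c) by field; rewrite gt_eqF.
  by rewrite normrM gtr0_norm// ltr_pM2l.
have [cl [clc clin clid]] := clamp R A B AB.
(* Clamping keeps the path inside the portion for all [t]; dividing by [c] undoes the scaling in
   [pattern]. *)
pose g t := (u, cl t / c).
have Xg t : X (g t) by exact: VX.
have Wg t : W (g t) by apply: Wu; apply: inW.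
have cg : continuous g.
  have cc : continuous (fun t => cl t / c).
    by move=> t; apply: cvgM; [exact: clc|exact: cvg_cst].
  by move=> t; exact: (cvg_pair (cvg_cst u) (cc t)).
have fg t (e : R) : 0 < e -> \forall s \near t,
    `|(f (g t)).1 - (f (g s)).1| < e /\ `|(f (g t)).2 - (f (g s)).2| < e.
  move=> e0; have [N tN NP] := WP _ (Xg t) (Wg t) e e0.
  apply: (@filterS _ (nbhs t) _ (g @^-1` N)); last exact: cg.
  move=> s /= Ns.
  by have := NP _ (Xg s) Ns; rewrite ![`|(f (g s)).1 - _|]distrC ![`|(f (g s)).2 - _|]distrC.
apply: (path_rigid R y k b (fun t => (f (g t)).1) (fun t => (f (g t)).2)).
- by rewrite /b dvdz_mulr.
- by move=> t; apply/cvgrPdist_lt => e e0; apply: filterS (fg t e e0) => s [].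
- by move=> t; apply/cvgrPdist_lt => e e0; apply: filterS (fg t e e0) => s [].
move=> t tAB; rewrite -surjective_pairing.
have -> : plane_code R y (f (g t)) = plane_code R x (g t) by rewrite fE.
have gE : g t = (u, t / c) by rewrite /g clid.
have pE : pattern R i (t / c) = odd_floor R (zigzag R p t).
  rewrite /pattern /i /= odd_double /= uphalf_double.
  by rewrite -/p -/c /= mulrCA divff ?mulr1// gt_eqF.
rewrite gE -pE; split=> [tp|[a' [n' [ax' /= uE' pat]]]].
  by exists (fun j => a j + (if j == i then 1 else 0)), i.
by have [_ ->] := code_inj R _ _ _ _ _ _ qx ax' uE'.
Qed.

Theorem theorem5p23 (R : realType) :
  exists C : set nat -> set (R * R)%type,
    (forall x : set nat, Fsigma (C x)) /\
    (forall x y : set nat, almost_subset x y <-> D2_le (C x) (C y)).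
Proof.
exists (plane_code R); split; first exact: Fsigma_plane_code.
move=> x y; split; last exact: D2_le_almost_subset.
by move=> /almost_subset_active[m]; exact: D2_le_plane_code.
Qed.
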